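(* Let $K$ be any field, let $S=K[x_1,\dots,x_n]$, and let $G$ be a finite simple graph on the vertex set $[n]$ with edge ideal $I=I(G)\subset S$. Write $t_i=t_i(S/I)$. If $t_j\geq \left\lceil \frac{3j}{2}\right\rceil$ for all integers $j$ with $5\leq j\leq \left\lfloor \frac{\mathrm{pd}_S(S/I)}{2}\right\rfloor$, then $I$ satisfies the subadditivity condition. In particular, if $\mathrm{pd}_S(S/I)\leq 9$, then $I$ satisfies the subadditivity condition.
   Context: $S=K[x_1,\dots,x_n]$ is standard graded ($\deg(x_i)=1$). For a finite simple graph $G$ on $[n]=\{1,\dots,n\}$ with edge set $E(G)$, the edge ideal is $I(G)=\langle x_ix_j : \{i,j\}\in E(G)\rangle\subset S$. The graded Betti numbers are $\beta_{i,j}(S/I)=\dim_K \mathrm{Tor}_i^S(S/I,K)_j$; $\mathrm{pd}_S(S/I)$ is the projective dimension of $S/I$; and for $0\le i\le \mathrm{pd}_S(S/I)$, $t_i(S/I)=\max\{j : \beta_{i,j}(S/I)\neq 0\}$ is the maximal shift in homological degree $i$ of the minimal graded free $S$-resolution of $S/I$. A graded ideal $I$ satisfies the subadditivity condition if $t_{a+b}(S/I)\leq t_a(S/I)+t_b(S/I)$ for all integers $a,b\geq 0$ with $a+b\leq \mathrm{pd}_S(S/I)$. *)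

(* Defs.v *)
From HB Require Import structures.
From mathcomp Require Import all_boot all_order all_algebra.
From mathcomp Require Import mpoly.
Set Implicit Arguments.
Unset Strict Implicit.
Unset Printing Implicit Defensive.
Import GRing.Theory.
Local Open Scope ring_scope.

Definition edge_ideal (K : fieldType) (n : nat) (E : rel 'I_n)
    (p : {mpoly K[n]}) : Prop :=
  exists c : 'I_n -> 'I_n -> {mpoly K[n]},
    p = \sum_(i < n) \sum_(j < n | E i j) c i j * ('X_i * 'X_j).

(* Graded free resolutions
     ... -> F_2 -> F_1 -> F_0 -> S/I -> 0,   S = K[x_1, ..., x_n],
   by free modules of finite rank, not necessarily minimal.  [F_i] is the
   module of row vectors of length [rk i], its [k]-th basis vector being placed
   in degree [shift i k], so that F_i = (+)_k S(- shift i k).  The differential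
   F_(i+1) -> F_i is v |-> v *m diff i, and F_0 -> S/I is the class modulo I of
   v |-> v *m aug.  All these maps preserve degrees. *)
Record resolution (K : fieldType) (n : nat) (I : {mpoly K[n]} -> Prop) :=
  Resolution {
    rk : nat -> nat;
    shift : forall i, 'I_(rk i) -> nat;
    aug : 'cV[{mpoly K[n]}]_(rk 0);
    diff : forall i, 'M[{mpoly K[n]}]_(rk i.+1, rk i);
    aug_homog : forall k, aug k 0 \is (shift k).-homog;
    diff_homog : forall i k l m, m \in msupp (diff i k l) ->
      (mdeg m + shift l)%N = shift k;
    aug_surj : forall p, exists v : 'rV_(rk 0), I (p - (v *m aug) 0 0);
    exact0 : forall v : 'rV_(rk 0),
      I ((v *m aug) 0 0) <-> exists w : 'rV_(rk 1), v = w *m diff 0;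
    exactS : forall i (v : 'rV_(rk i.+1)),
      v *m diff i = 0 <-> exists w : 'rV_(rk i.+2), v = w *m diff i.+1
  }.
Arguments shift {K n I} r i k.

Section Invariants.
Variables (K : fieldType) (n : nat) (I : {mpoly K[n]} -> Prop).
Implicit Type F : resolution I.

(* K = S/(x_1, ..., x_n), so the matrix of diff i (x) K consists of the constant
   coefficients of the entries of diff i. *)
Definition diffK F i : 'M[K]_(rk F i.+1, rk F i) :=
  map_mx (mcoeff 0%MM) (diff F i).

(* Its row space is the degree j component of F_i (x) K. *)
Definition degree_part F i j : 'M[K]_(rk F i) :=
  diag_mx (\row_k (shift F i k == j)%:R).

Definition cycles F i j : 'M[K]_(rk F i) :=
  match i return 'M[K]_(rk F i) with
  | 0 => degree_part F 0 j
  | i'.+1 => (degree_part F i'.+1 j :&: kermx (diffK F i'))%MS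
  end.

Definition boundaries F i j : 'M[K]_(rk F i.+1, rk F i) :=
  degree_part F i.+1 j *m diffK F i.

(* The dimension of Tor_i^S(S/I, K)_j, which is the degree j part of the i-th
   homology of F (x) K; up to isomorphism it does not depend on F. *)
Definition betti F i j : nat :=
  (\rank (cycles F i j) - \rank (boundaries F i j))%N.

(* By betti_eq0 below, the bound on j does not restrict the maximum. *)
Definition max_shift F i : nat :=
  \max_(j < (\max_k shift F i k).+1 | betti F i j != 0%N) j.

Definition length_le F (d : nat) : Prop := forall i, (d < i)%N -> rk F i = 0%N.

Definition is_pd (p : nat) : Prop :=
  (exists F, length_le F p) /\ (forall F d, length_le F d -> (p <= d)%N).

(* [p] stands for the projective dimension of S/I. *)
Definition subadditive F (p : nat) : Prop :=
  forall a b : nat, (a + b <= p)%N ->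
    (max_shift F (a + b) <= max_shift F a + max_shift F b)%N.

Lemma betti_eq0 F i j :
  (\max_k shift F i k < j)%N -> betti F i j = 0%N.
Proof.
move=> hj; have D0 : degree_part F i j = 0.
  apply/matrixP=> k l; rewrite !mxE.
  case: (eqVneq k l) => [_|_]; last by rewrite mulr0n.
  case: eqP => // e; move: hj; rewrite -e ltnNge.
  by rewrite (leq_bigmax (F := fun k => shift F i k)).
rewrite /betti; suff -> : cycles F i j = 0 by rewrite mxrank0.
case: i hj D0 => [|i] _ /= -> //.
by apply/eqP; rewrite -submx0 capmxSl.
Qed.

Lemma leq_max_shift F i j : betti F i j != 0%N -> (j <= max_shift F i)%N.
Proof.
move=> hj; have lt_j : (j < (\max_k shift F i k).+1)%N.
  by rewrite ltnS leqNgt; apply: contra hj => /betti_eq0 ->.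
exact: (leq_bigmax_cond (Ordinal lt_j)).
Qed.

Lemma betti_max_shift F i j :
  betti F i j != 0%N -> betti F i (max_shift F i) != 0%N.
Proof.
move=> hj; have lt_j : (j < (\max_k shift F i k).+1)%N.
  by rewrite ltnS leqNgt; apply: contra hj => /betti_eq0 ->.
by rewrite /max_shift (bigmax_eq_arg (Ordinal lt_j)) //; case: arg_maxnP.
Qed.

End Invariants.

(* Main.v *)
From HB Require Import structures.
From mathcomp Require Import all_boot all_order all_algebra.
From mathcomp Require Import mpoly.
From mathcomp Require Import zify ring.
From Stdlib Require Import Classical_Prop IndefiniteDescription.
Require Import Defs.
Set Implicit Arguments.
Unset Strict Implicit.
Unset Printing Implicit Defensive.
Import GRing.Theory.

(** By Hochster's formula, Tor_i(S/I, K)_j is nonzero exactly when some set W of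
j vertices has nonzero reduced cohomology, carried by faces of c = j - i
vertices, in the independence complex of G restricted to W. Call such a pair (W,
c) nonacyclic; its homological degree is i = |W| - c. The theorem becomes a
statement on how to shrink W: from a nonacyclic pair of homological degree a +
b, reach one of homological degree a after losing at most t_b vertices.

There is one tool, [nonacyclic_star]. Either a single vertex can be deleted with
c unchanged (i drops by 1), or, for every vertex u and every nonempty set A of
neighbours of u in W, the set W - u - A is nonacyclic for c - 1 (i drops by |A|,
and one more vertex than that is lost). It comes from a Mayer-Vietoris argument
for the deletions of u and of a neighbour w of u: the class on W - u - w that it
produces stays nonzero on the link of u, which is W - N[u], hence on everything
in between.

Let a >= b. Deleting single vertices or stars with |A| = 2, and |A| = 1 if i has
to drop only by 1 at the end, loses at most ceil(3b/2) vertices while i drops by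
b, unless one gets stuck at a set inducing a perfect matching; in that case t_b
= 2b, and dropping i by b never costs more than 2b vertices. This settles every
b with t_b >= ceil(3b/2) ([max_shift_add_half]), in particular b = 1, 2, since
t_b > b.

For b = 3, 4 it remains to treat t_b = b + 1 ([max_shift_add_small]). One tries
to lose at most b + 1 vertices, by single deletions and by one star with |A|
equal to the drop of i that remains. If no vertex has enough neighbours, all
degrees are less than b, and one descends to homological degree b keeping c >=
2, which contradicts t_b = b + 1. The descent could only stop at a set W,
minimal with nonzero first cohomology, with |W| >= b + 3; there, deleting any
two adjacent vertices leaves a graph which is a join, and the degree bound makes
this impossible ([nonacyclic_cycle_deg]).

Hochster's formula is proved for the given resolution F, which need not be
minimal. The double complex of F tensored with the Koszul complex of x_1, ...,
x_n has exact rows and columns, so a cycle which is not a boundary can be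
carried step by step from the edge F (x) K to the edge Koszul (x) S/I and back
([zigzag]). The latter complex splits by multidegree. It is contractible in a
multidegree which is not squarefree, and in the multidegree of W it is, up to
signs, the cochain complex of the independence complex on W
([tor_of_nonacyclic], [nonacyclic_of_tor]). *)

(** * Signs and Koszul differentials *)

Lemma card_rem (T : finType) (W : {set T}) v : v \in W -> #|W :\ v|.+1 = #|W|.
Proof. by move=> vW; rewrite (cardsD1 v W) vW. Qed.

Section Koszul.
Local Open Scope ring_scope.
Variables (n : nat) (R : comNzRingType).
Implicit Types (B : {set 'I_n}) (k l : 'I_n) (x : 'I_n -> R) (z : {set 'I_n} -> R).

Definition nbelow k B := #|[set l in B | (l < k)%N]|.

Lemma nbelowD1 k l B : l \in B -> nbelow k B = ((l < k) + nbelow k (B :\ l))%N.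
Proof.
move=> lB; rewrite /nbelow (cardsD1 l) inE lB /=; congr addn.
by apply: eq_card => y; rewrite !inE andbA.
Qed.

Lemma nbelow_self k B : nbelow k (B :\ k) = nbelow k B.
Proof.
by apply: eq_card => y; rewrite !inE; case: eqVneq => [->|] //=; rewrite ltnn andbF.
Qed.

Definition sgn k B : R := (-1) ^+ nbelow k B.

Lemma sgnK k B : sgn k B * sgn k B = 1.
Proof. by rewrite /sgn -exprMn mulN1r opprK expr1n. Qed.

Lemma sgn_self k B : sgn k (B :\ k) = sgn k B.
Proof. by rewrite /sgn nbelow_self. Qed.

Lemma sgn_swap k l B : k != l -> k \in B -> l \in B ->
  sgn k B * sgn l (B :\ k) = - (sgn l B * sgn k (B :\ l)).
Proof.
move=> kl kB lB; rewrite /sgn (nbelowD1 k lB) (nbelowD1 l kB) !exprD.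
have : (k : nat) != l by [].
by rewrite neq_ltn => /orP[] h; rewrite h ltnNge (ltnW h) /= expr0 expr1; ring.
Qed.

(** The Koszul differential, indexed by the complement of the usual exterior
degree, so that it adds elements to B. With x constant equal to 1 it is the
simplicial coboundary; with x the variables it is the Koszul complex of S, in
homological degree n - |B|. *)
Definition kosz x z B := \sum_(k in B) sgn k B * x k * z (B :\ k).

Lemma eq_kosz x z z' B : (forall k, k \in B -> z (B :\ k) = z' (B :\ k)) ->
  kosz x z B = kosz x z' B.
Proof. by move=> h; apply: eq_bigr => k kB; rewrite h. Qed.

Lemma koszB x z z' B : kosz x (fun B => z B - z' B) B = kosz x z B - kosz x z' B.
Proof. by rewrite -sumrB; apply: eq_bigr => k _; rewrite mulrBr. Qed.

Lemma koszD x z z' B : kosz x (fun B => z B + z' B) B = kosz x z B + kosz x z' B.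
Proof. by rewrite -big_split; apply: eq_bigr => k _; rewrite mulrDr. Qed.

Lemma koszMr x z a B : kosz x (fun B => z B * a) B = kosz x z B * a.
Proof. by rewrite mulr_suml; apply: eq_bigr => k _; rewrite mulrA. Qed.

Lemma kosz_sum (I : finType) x (z : I -> {set 'I_n} -> R) B :
  kosz x (fun B => \sum_i z i B) B = \sum_i kosz x (z i) B.
Proof. by rewrite exchange_big; apply: eq_bigr => k _; rewrite mulr_sumr. Qed.

(** The two orders in which k and l can be removed contribute with opposite
signs; the terms are paired off since 2 may vanish in R. *)
Lemma kosz_kosz x z B : kosz x (kosz x z) B = 0.
Proof.
pose t k l := sgn k B * x k * (sgn l (B :\ k) * x l * z (B :\ k :\ l)).
have tC k l : k != l -> k \in B -> l \in B -> t k l = - t l k.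
  move=> kl kB lB; rewrite /t (setDDl B [set k]) setUC -setDDl.
  have -> : sgn k B * x k * (sgn l (B :\ k) * x l * z (B :\ l :\ k)) =
    (sgn k B * sgn l (B :\ k)) * (x k * x l * z (B :\ l :\ k)) by ring.
  by rewrite (sgn_swap kl kB lB); ring.
have -> : kosz x (kosz x z) B =
    \sum_(k in B) (\sum_(l in B | (l < k)%N) t k l + \sum_(l in B | (k < l)%N) t k l).
  apply: eq_bigr => k kB; rewrite mulr_sumr (bigID (fun l : 'I_n => (l < k)%N)) /=.
  by congr (_ + _); apply: eq_bigl => l; rewrite !inE -val_eqE /=;
    case: (l \in B); rewrite ?andbF ?andbT //=; lia.
rewrite big_split /= -[X in X + _]opprK -sumrN; apply/eqP; rewrite addrC subr_eq0.
apply/eqP; under [RHS]eq_bigr do rewrite -sumrN.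
rewrite (exchange_big_dep (mem B)) /=; last by move=> i j _ /andP[].
apply: eq_bigr => l lB; rewrite (eq_bigl (fun k : 'I_n => (k \in B) && (k < l)%N)).
  by apply: eq_bigr => k /andP[kB kl]; apply: tC => //; rewrite -val_eqE /= ltn_eqF.
by move=> k; rewrite lB.
Qed.

(** Contraction with the k-th basis vector, a homotopy from multiplication by
x_k to zero. *)
Definition contract k z B := if k \in B then 0 else sgn k B * z (k |: B).

Lemma kosz_homotopy x k z B :
  kosz x (contract k z) B + contract k (kosz x z) B = x k * z B.
Proof.
rewrite {2}/contract; case: ifPn => kB.
  rewrite addr0 /kosz (bigD1 k) //= big1 ?addr0.
    by rewrite /contract !inE eqxx /= setD1K // sgn_self mulrAC mulrA mulrAC -mulrA sgnK; ring.
  by move=> l /andP[lB lk]; rewrite /contract !inE eq_sym lk kB mulr0.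
have kkB : k \in k |: B by rewrite setU11.
have Bk : (k |: B) :\ k = B by rewrite setU1K.
have e1 : sgn k (k |: B) = sgn k B by rewrite -[in RHS]Bk sgn_self.
rewrite [X in sgn k B * X]/kosz (bigD1 k) //= Bk e1 mulrDr !mulrA sgnK mul1r.
rewrite addrCA [X in _ + X](_ : _ = 0) ?addr0 //.
rewrite mulr_sumr (eq_bigl (mem B)); last first.
  move=> l /=; rewrite !inE; case: eqVneq => [->|_]; last by rewrite andbT.
  by rewrite (negPf kB).
rewrite /kosz -big_split big1 //= => l lB.
have lk : l != k by apply: contraNneq kB => <-.
have lkB : l \in k |: B by rewrite !inE lB orbT.
rewrite /contract !inE eq_sym (negPf lk) (negPf kB) /=.
have e : k |: B :\ l = (k |: B) :\ l.
  by apply/setP=> y; rewrite !inE; case: (eqVneq y k) => [->|]//=; rewrite eq_sym lk.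
rewrite e; have := sgn_swap lk lkB kkB; rewrite Bk => h.
have -> : sgn k (B :\ l) = sgn k ((k |: B) :\ l).
  by rewrite -e -[in RHS]sgn_self setU1K // !inE eq_sym lk.
have -> : sgn l B * x l * (sgn k ((k |: B) :\ l) * z ((k |: B) :\ l)) =
  sgn l (k |: B) * sgn l (k |: B) * (sgn l B * x l * (sgn k ((k |: B) :\ l) * z ((k |: B) :\ l))).
  by rewrite sgnK mul1r.
have -> : sgn l (k |: B) * sgn l (k |: B) * (sgn l B * x l * (sgn k ((k |: B) :\ l) * z ((k |: B) :\ l)))
  = (sgn l (k |: B) * sgn k ((k |: B) :\ l)) * (sgn l (k |: B) * sgn l B * x l * z ((k |: B) :\ l)) by ring.
rewrite h e1.
have -> : - (sgn k B * sgn l B) * (sgn l (k |: B) * sgn l B * x l * z ((k |: B) :\ l))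
 = - (sgn l B * sgn l B) * (sgn k B * sgn l (k |: B) * x l * z ((k |: B) :\ l)) by ring.
by rewrite sgnK; ring.
Qed.

End Koszul.

(** * Cohomology of independence complexes *)

Section Cohomology.
Local Open Scope ring_scope.
Variables (K : fieldType) (n : nat) (E : rel 'I_n).
Hypotheses (E_sym : ssrbool.symmetric E) (E_irr : irreflexive E).
Implicit Types (u v w x y : 'I_n) (A B W s t : {set 'I_n}) (f g : {set 'I_n} -> K).

Definition indep s := [forall x in s, forall y in s, ~~ E x y].

Lemma indepP s : reflect (forall x y, x \in s -> y \in s -> ~~ E x y) (indep s).
Proof.
by apply: (iffP forall_inP) => [h x y /h/forall_inP|h x xs]; [apply | apply/forall_inP => y; apply: h].
Qed.

Lemma indepS s t : s \subset t -> indep t -> indep s.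
Proof. by move=> /subsetP st /indepP h; apply/indepP => x y /st ? /st; apply: h. Qed.

Definition coboundary f s : K := kosz (fun=> 1) f s.

(** Cochains on the subcomplex induced by W are functions on all sets, of which
only the values at the independent subsets of W matter. Restriction to a smaller
W is then the identity on functions. The number c is the size of the faces, one
more than their dimension. *)
Definition cocycle_on W c f :=
  forall s, s \subset W -> indep s -> #|s| = c.+1 -> coboundary f s = 0.

Definition exact_on W c f :=
  exists g, forall s, s \subset W -> indep s -> #|s| = c -> f s = coboundary g s.

Definition nonacyclic W c := exists2 f, cocycle_on W c f & ~ exact_on W c f.

Definition nbrs W u := [set w in W | E u w].

Lemma cocycle_onS W W' c f : W' \subset W -> cocycle_on W c f -> cocycle_on W' c f.
Proof. by move=> WW' h s sW'; apply: h; apply: subset_trans WW'. Qed.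

Lemma nonacyclic_leq W c : nonacyclic W c -> (c <= #|W|)%N.
Proof.
case=> f _ nf; rewrite leqNgt; apply/negP => cW; apply: nf; exists (fun=> 0) => s /subset_leq_card.
lia.
Qed.

(** A vertex without neighbours in W is a cone point of the complex, and
contraction with it is a homotopy to zero. *)
Lemma nonacyclic_nbr W c v : nonacyclic W c -> v \in W -> exists2 w, w \in W & E v w.
Proof.
case=> f cf nf vW; apply: NNPP => nv; apply: nf; exists (contract v f) => s sW si sc.
have := kosz_homotopy (fun=> 1) v f s; rewrite mul1r => <-.
rewrite -[RHS]addr0; congr (_ + _); rewrite /contract; case: ifPn => // vs.
rewrite [kosz _ _ _]cf ?mulr0 //; last by rewrite cardsU1 vs sc.
  by rewrite subUset sub1set vW.
apply/indepP => x y; have h z : z \in s -> ~~ E v z.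
  by move=> zs; apply/negP => vz; apply: nv; exists z => //; apply: (subsetP sW).
rewrite !inE => /orP[/eqP->|xs] /orP[/eqP->|ys]; rewrite ?E_irr ?h //.
- by rewrite E_sym h.
- by move/indepP: si; apply.
Qed.

Lemma nonacyclic0 W : nonacyclic W 0 -> W = set0.
Proof.
case=> f cf nf; apply: NNPP => /eqP/set0Pn[x xW]; case: nf; exists (fun=> 0) => s _ _ /cards0_eq ->.
have: coboundary f [set x] = 0.
  apply: cf; rewrite ?sub1set ?cards1 //.
  by apply/indepP => y z /set1P-> /set1P->; rewrite E_irr.
rewrite /coboundary /kosz big_set1 setDv mulr1 => /(congr1 (GRing.mul (sgn K x [set x]))).
by rewrite mulrA sgnK mul1r mulr0 big_set0.
Qed.

(** If f = d g1 without u and f = d g2 without w, then g1 - g2 is a cocycle off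
u and w. Were it d k off u and A, one could correct g2 by the product of u with
k on the faces through u, whose other vertices are not neighbours of u and so
lie in the domain of k; glued with g1 on the other faces, this would make f a
coboundary on W. *)
Lemma nonacyclic_star W A c u w : nonacyclic W c.+1 -> u \in W -> w \in A -> A \subset nbrs W u ->
  [\/ nonacyclic (W :\ u) c.+1, nonacyclic (W :\ w) c.+1 | nonacyclic (W :\ u :\: A) c].
Proof.
case=> f cf nf uW wA AN.
have exact_or W' : W' \subset W -> exact_on W' c.+1 f \/ nonacyclic W' c.+1.
  move=> W'W; case: (classic (exact_on W' c.+1 f)) => [|nf']; [by left|right].
  by exists f => //; apply: cocycle_onS W'W cf.
case: (exact_or (W :\ u)) => [|[g1 hg1]|]; [exact: subsetDl | | by constructor 1].
case: (exact_or (W :\ w)) => [|[g2 hg2]|]; [exact: subsetDl | | by constructor 2].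
constructor 3; pose h s := g1 s - g2 s; exists h => [s sW si sc|[k hk]].
  rewrite /coboundary koszB -[kosz _ g1 s]hg1 // -?[kosz _ g2 s]hg2 ?subrr //.
    move: sW; rewrite !subsetD1 subsetD subsetD1 -andbA => /and3P[-> _ /pred0P/(_ w) /=].
    by rewrite wA andbT => ->.
  by move: sW; rewrite subsetD => /andP[].
apply: nf; pose g s := if u \in s then g2 s + (sgn K u s * k (s :\ u)) else g1 s.
exists g => t tW ti tc; have [ut|ut] := boolP (u \in t); last first.
  rewrite (hg1 t) ?subsetD1 ?tW //; apply: eq_kosz => x xt.
  by rewrite /g !inE (negPf ut) andbF.
have tN x : x \in t -> x \notin nbrs W u.
  by move=> xt; rewrite inE; move/indepP: ti => ti; rewrite (negPf (ti _ _ ut xt)) andbF.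
have wt : w \notin t by apply/negP => /tN; rewrite (subsetP AN).
have tuc : #|t :\ u| = c by move: (cardsD1 u t); rewrite ut tc add1n => -[].
have htu : h (t :\ u) = coboundary k (t :\ u).
  apply: hk => //; last by apply: indepS ti; rewrite subsetDl.
  rewrite subsetD setSD //=; apply/pred0P => x /=; apply/negP => /andP[].
  by rewrite inE => /andP[_ /tN]; move/negP=> xn xA; apply: xn; apply: (subsetP AN).
have e2 := hg2 t _ ti tc; rewrite e2 ?subsetD1 ?tW //.
rewrite /coboundary /kosz !(bigD1 u ut) /= !mulr1 [g (t :\ u)]/g setD11.
have : g1 (t :\ u) = g2 (t :\ u) + coboundary k (t :\ u).
  by rewrite -htu /h addrC subrK.
move=> ->; rewrite mulrDr -addrA; congr (_ + _).
rewrite /coboundary /kosz mulr_sumr.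
rewrite [X in _ = X + _](eq_bigl (fun x => (x \in t) && (x != u))); last first.
  by move=> x; rewrite !inE andbC.
rewrite -big_split; apply: eq_bigr => x /andP[xt xu] /=.
rewrite /g !inE eq_sym xu ut /= !mulr1 mulrDr addrCA -[LHS]addr0; congr (_ + _).
rewrite (setDDl t [set u]) [_ :|: _]setUC -setDDl !mulrA.
have ux : u != x by rewrite eq_sym.
by rewrite (sgn_swap K ux ut xt) mulNr addNr.
Qed.

(** The class is a nonconstant function on W which is constant on the connected
components of the complex: the complex is disconnected, so the graph is a join.
*)
Lemma nonacyclic1 W : nonacyclic W 1 ->
  exists C1 C2, [/\ C1 :|: C2 = W, [disjoint C1 & C2], C1 != set0, C2 != set0 &
     forall x y, x \in C1 -> y \in C2 -> E x y].
Proof.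
case=> f cf nf.
have [x0 x0W] : exists x, x \in W.
  apply/set0Pn/eqP => W0; apply: nf; exists (fun=> 0) => s; rewrite W0 subset0 => /eqP-> _.
  by rewrite cards0.
exists [set x in W | f [set x] == f [set x0]], [set x in W | f [set x] != f [set x0]]; split.
- by apply/setP=> x; rewrite !inE -andb_orr orbN andbT.
- by apply/pred0P => x /=; rewrite !inE; case: eqP; rewrite ?andbF.
- by apply/set0Pn; exists x0; rewrite inE x0W eqxx.
- apply/negP => /eqP C0; apply: nf; exists (fun=> f [set x0]) => s sW si /eqP/cards1P[x ex].
  rewrite ex /coboundary /kosz big_set1 mulr1.
  have -> : sgn K x [set x] = 1.
    rewrite /sgn /nbelow [X in #|pred_of_set X|](_ : _ = set0) ?cards0 //.
    by apply/setP => y; rewrite !inE; case: eqP => // ->; rewrite ltnn.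
  rewrite mul1r; apply/eqP; have xW : x \in W by rewrite -sub1set -ex.
  by apply: contraFT (in_set0 x) => ne; rewrite -C0 inE xW.
move=> x y; rewrite !inE => /andP[xW /eqP fx] /andP[yW fy]; apply/negPn/negP => nE.
have xy : x != y by apply: contraNneq fy => <-; apply/eqP.
case/eqP: fy; rewrite -fx.
have: coboundary f [set x; y] = 0.
  apply: cf; rewrite ?cards2 ?xy //; first by rewrite subUset !sub1set xW.
  apply/indepP => a b; rewrite !inE => /orP[]/eqP-> /orP[]/eqP->; rewrite ?E_irr //.
  by rewrite E_sym.
have xy1 : [set x; y] :\ x = [set y] by rewrite setU1K // inE.
have xy2 : [set x; y] :\ y = [set x] by rewrite setUC setU1K // inE eq_sym.
rewrite /coboundary /kosz big_setU1 ?inE //= big_set1 xy1 xy2 !mulr1.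
have := sgn_swap K xy (set21 x y) (set22 x y); rewrite xy1 xy2.
have s1 z : sgn K z [set z] = 1.
  rewrite /sgn /nbelow [X in #|pred_of_set X|](_ : _ = set0) ?cards0 //.
  by apply/setP => a; rewrite !inE; case: eqP => // ->; rewrite ltnn.
rewrite !s1 !mulr1 => ->; rewrite mulNr addrC => /eqP; rewrite subr_eq0 => /eqP e.
by have := congr1 (GRing.mul (sgn K y [set x; y])) e; rewrite !mulrA !sgnK !mul1r.
Qed.

End Cohomology.

(** * Shrinking nonacyclic sets *)

(** The type of finite sets of ordinals is elaborated with identity wrappers,
which must be unfolded for lia to identify cardinals. *)
Local Ltac slia := cbv [reverse_coercion] in *; lia.

Section Combinatorics.
Variables (K : fieldType) (n : nat) (E : rel 'I_n).
Hypotheses (E_sym : ssrbool.symmetric E) (E_irr : irreflexive E).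
Implicit Types (u v w x y : 'I_n) (A B W : {set 'I_n}).
Local Notation nz := (nonacyclic K E).
Local Notation N := (nbrs E).

Lemma cards_star W A u : u \in W -> A \subset N W u ->
  #|W :\ u :\: A| + #|A| + 1 = #|W|.
Proof.
move=> uW AN; rewrite (cardsD1 u W) uW /= cardsD (setIidPr _).
  rewrite subnK ?addn1 //.
  apply: subset_leq_card; apply: (subset_trans AN).
  apply/subsetP=> x; rewrite !inE => /andP[-> ux]; rewrite andbT.
  by apply: contraTneq ux => ->; rewrite E_irr.
apply: (subset_trans AN).
apply/subsetP=> x; rewrite !inE => /andP[-> ux]; rewrite andbT.
by apply: contraTneq ux => ->; rewrite E_irr.
Qed.

Lemma nonacyclic_gt0 W c : nz W c -> W != set0 -> (0 < c).
Proof. by case: c => // /(nonacyclic0 E_irr)->; rewrite eqxx. Qed.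

(** If c = |W|, the only possible face of size c is W; but some vertex of W has
a neighbour, so that W is not a face. *)
Lemma nonacyclic_lt W c : nz W c -> W != set0 -> c < #|W|.
Proof.
move=> h W0; rewrite ltn_neqAle (nonacyclic_leq h) andbT; apply/negP => /eqP e.
case: (h) => f _ []; exists (fun=> 0%R) => s sW si sc.
have sWe : s = W by apply/eqP; rewrite eqEcard sW sc e leqnn.
have /set0Pn[v vW] := W0; have [w wW] := nonacyclic_nbr E_sym E_irr h vW.
by move/indepP: si => /(_ v w); rewrite sWe => /(_ vW wW)/negPf->.
Qed.

Lemma nonacyclic_remove_or_star W c u m : nz W c -> u \in W -> 0 < m -> m <= #|N W u| ->
  (exists2 v, v \in W & nz (W :\ v) c) \/
  exists2 W' : {set 'I_n}, W' \subset W & [/\ #|W'| + m.+1 = #|W|, 0 < c & nz W' c.-1].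
Proof.
move=> h uW m0 mN.
have c0 : 0 < c by apply: (nonacyclic_gt0 h); apply/set0Pn; exists u.
have [A AN Am] : exists2 A : {set 'I_n}, A \subset N W u & #|A| = m.
  have [s [us ss sN]] := card_geqP mN; exists [set x in s].
    by apply/subsetP => x; rewrite inE; apply: sN.
  by rewrite cardsE (card_uniqP us).
have /set0Pn[w wA] : A != set0 by rewrite -cards_eq0 Am -lt0n.
have wW : w \in W by move/(subsetP AN): wA; rewrite inE => /andP[].
case: c c0 h => // c _ h.
case: (nonacyclic_star h uW wA AN) => h'; [by left; exists u|by left; exists w|right].
exists (W :\ u :\: A); first by apply: subset_trans (subsetDl _ _) (subsetDl _ _).
by split => //; rewrite -(cards_star uW AN) Am; slia.
Qed.

Lemma nonacyclic_down1 W c : nz W c -> W != set0 ->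
  (exists2 v, v \in W & nz (W :\ v) c) \/
  exists2 W' : {set 'I_n}, W' \subset W & [/\ #|W'| + 2 = #|W|, 0 < c & nz W' c.-1].
Proof.
move=> h /set0Pn[u uW]; apply: (nonacyclic_remove_or_star h uW) => //.
have [w wW uw] := nonacyclic_nbr E_sym E_irr h uW.
by rewrite card_gt0; apply/set0Pn; exists w; rewrite inE wW.
Qed.

(** Stars with a single leaf lose two vertices when i drops by 1. *)
Lemma nonacyclic_down m W c : nz W c -> m <= #|W| - c ->
  exists (W' : {set 'I_n}) c', [/\ W' \subset W, nz W' c', #|W'| + c + m = #|W| + c' & c <= c' + m].
Proof.
elim: m W c => [|m IH] W c h mW; first by exists W, c; split=> //; slia.
have cW := nonacyclic_leq h.
have W0 : W != set0 by apply: contraTneq mW => W0; move: cW; rewrite W0 cards0; slia.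
have cW' := nonacyclic_lt h W0.
case: (nonacyclic_down1 h W0) => [[v vW h1]|[W1 W1W [e c0 h1]]].
  have e := card_rem vW.
  have [|W' [c' [s ? ? ?]]] := IH _ _ h1; first by slia.
  by exists W', c'; split => //; [apply: subset_trans s (subsetDl _ _)|slia|slia].
have [|W' [c' [s ? ? ?]]] := IH _ _ h1; first by slia.
by exists W', c'; split => //; [apply: subset_trans s _|slia|slia].
Qed.

Lemma nbrsS W W' u : W' \subset W -> N W' u \subset N W u.
Proof. by move=> s; apply/subsetP => x; rewrite !inE => /andP[/(subsetP s)-> ->]. Qed.

(** In a perfect matching the deletion of a single vertex leaves its partner
isolated, so that every step removes an edge. *)
Lemma nonacyclic_matching W c : nz W c -> (forall u, u \in W -> #|N W u| <= 1) -> #|W| = 2 * c.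
Proof.
elim: {W}_.+1 {-2}W c (ltnSn #|W|) => // k IH W c kW h deg.
have [W0|W0] := eqVneq W set0; first by have := nonacyclic_leq h; rewrite W0 cards0; slia.
case: (nonacyclic_down1 h W0) => [[v vW h1]|[W1 W1W [e c0 h1]]]; last first.
  have : #|W1| = 2 * c.-1; last by slia.
  apply: (IH _ _ _ h1); first by slia.
  move=> u /(subsetP W1W)/deg; apply: leq_trans; exact: subset_leq_card (nbrsS _ _).
have [w wW vw] := nonacyclic_nbr E_sym E_irr h vW.
have wv : w != v by apply: contraTneq vw => ->; rewrite E_irr.
have wWv : w \in W :\ v by rewrite !inE wv.
have [x xW wx] := nonacyclic_nbr E_sym E_irr h1 wWv.
have := deg w wW; rewrite leqNgt => /negP[]; apply/card_gt1P; exists v, x.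
move: xW; rewrite !inE => /andP[xv xW]; split; rewrite ?inE ?vW ?xW //=; first by rewrite E_sym.
by rewrite eq_sym.
Qed.

(** A star with two leaves lowers i by 2 and c by 1. It is available unless the
graph on the current set is a perfect matching, or i has to drop by 1 only; the
latter happens once, which accounts for rounding up. *)
Lemma nonacyclic_down_half m W c : nz W c -> m <= #|W| - c ->
  (exists W' c', [/\ nz W' c', #|W'| + c + m = #|W| + c' & c <= c' + (m.+1)./2]) \/
  (exists W' c', [/\ nz W' c', #|W| + c' <= #|W'| + c + m & #|W'| = 2 * c']).
Proof.
elim: {m}_.+1 {-2}m W c (ltnSn m) => // k IH m W c mk h mW.
case: m mk mW => [|m] mk mW; first by left; exists W, c; split => //=; slia.
have cW := nonacyclic_leq h.
have W0 : W != set0 by apply: contraTneq mW => W0; move: cW; rewrite W0 cards0; slia.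
have cW' := nonacyclic_lt h W0.
have single v : v \in W -> nz (W :\ v) c ->
    (exists W' c', [/\ nz W' c', #|W'| + c + m.+1 = #|W| + c' & c <= c' + (m.+2)./2]) \/
  (exists W' c', [/\ nz W' c', #|W| + c' <= #|W'| + c + m.+1 & #|W'| = 2 * c']).
  move=> vW h1; have e := card_rem vW.
  have [||[W' [c' [? ? ?]]]|[W' [c' [? ? ?]]]] := IH m _ _ _ h1; [slia|slia|left|right];
    exists W', c'; split => //; slia.
case: m mk mW single => [|m] mk mW single.
  case: (nonacyclic_down1 h W0) => [[v vW h1]|[W1 W1W [e c0 h1]]]; first exact: single h1.
  by left; exists W1, c.-1; split => //; slia.
have [/exists_inP[u uW deg]|/exists_inPn deg] := boolP [exists u in W, 1 < #|N W u|].
  case: (nonacyclic_remove_or_star h uW _ deg) => // [[v vW h1]|[W1 W1W [e c0 h1]]]; first exact: single h1.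
  have [||[W' [c' [? ? ?]]]|[W' [c' [? ? ?]]]] := IH m _ _ _ h1; [slia|slia|left|right];
    exists W', c'; split => //; slia.
right; exists W, c; split => //; first by slia.
by apply: (nonacyclic_matching h) => u /deg; rewrite -leqNgt.
Qed.

(** Such a W would be a chordless cycle of the complementary graph, in which the
degrees are |W| - 3 >= b. For these b, counting is enough. Deleting an edge u w
leaves a join of C1 and C2, of sizes at most b - 1 and of total size at least b
+ 1, so that the larger one, C2, has b - 1 elements and every vertex of C1 has
C2 as its neighbourhood. Deleting an edge c1 c2 across this join leaves again a
join; the part not containing the rest of C1 lies in C2, hence a vertex d in it
is adjacent to C1, u and w, which are too many. *)
Lemma nonacyclic_cycle_deg b W : 3 <= b <= 4 -> nz W 2 -> (forall v, v \in W -> ~ nz (W :\ v) 2) ->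
  b + 3 <= #|W| -> (forall u, u \in W -> #|N W u| < b) -> False.
Proof.
move=> b34 h minW bW deg.
have join u w : u \in W -> w \in W -> E u w -> exists C1 C2,
    [/\ C1 :|: C2 = W :\ u :\ w, [disjoint C1 & C2], C1 != set0, C2 != set0 &
     forall x y, x \in C1 -> y \in C2 -> E x y].
  move=> uW wW uw; apply: (nonacyclic1 (K := K) E_sym E_irr).
  have wN : [set w] \subset N W u by rewrite sub1set inE wW.
  by case: (nonacyclic_star h uW (set11 w) wN) => // [/(minW _ uW)|/(minW _ wW)].
have /set0Pn[u uW] : W != set0 by rewrite -card_gt0; slia.
have [w wW uw] := nonacyclic_nbr E_sym E_irr h uW.
have wu : w != u by apply: contraTneq uw => ->; rewrite E_irr.
have [C1 [C2 [eC dC C1n C2n EC]]] := join _ _ uW wW uw.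
wlog C2b : C1 C2 eC dC C1n C2n EC / #|C1| <= #|C2|.
  move=> H; case: (leqP #|C1| #|C2|) => [|/ltnW]; first exact: (H C1 C2).
  apply: (H C2 C1) => //; rewrite 1?setUC 1?disjoint_sym // => x y xC yC.
  by rewrite E_sym EC.
have WC : #|C1| + #|C2| + 2 = #|W|.
  have := leq_card_setU C1 C2; case=> _; rewrite dC eC => /eqP e; rewrite -e.
  rewrite (cardsD1 u W) uW (cardsD1 w (W :\ u)) !inE wu wW /=; slia.
have CW x : (x \in C1) || (x \in C2) -> [/\ x \in W, x != u & x != w].
  by rewrite -in_setU eC !inE => /and3P[].
have /set0Pn[c1 c1C] := C1n; have /set0Pn[c2 c2C] := C2n.
have c1W : c1 \in W by case: (CW c1) => //; rewrite c1C.
have c2W : c2 \in W by case: (CW c2) => //; rewrite c2C orbT.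
have C2N x : x \in C1 -> C2 \subset N W x.
  by move=> xC; apply/subsetP => y yC; rewrite inE EC // andbT; case: (CW y) => //; rewrite yC orbT.
have C1N x : x \in C2 -> C1 \subset N W x.
  by move=> xC; apply/subsetP => y yC; rewrite inE E_sym EC // andbT; case: (CW y) => //; rewrite yC.
have p1 := subset_leq_card (C2N _ c1C); have p2 := deg _ c1W.
have C2e : #|C2|.+1 = b by move: C2b WC p1 p2 bW b34; clear; slia.
have p3 : 1 < #|C1| by move: WC C2e bW b34; clear; slia.
have NC2 x : x \in C1 -> N W x = C2.
  move=> xC; apply/esym/eqP; rewrite eqEcard C2N //=.
  by rewrite -ltnS C2e deg //; case: (CW x) => //; rewrite xC.
have /set0Pn[c] : C1 :\ c1 != set0 by rewrite -card_gt0 -ltnS (card_rem c1C).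
rewrite !inE => /andP[cc1 cC].
have [D1 [D2 [eD dD D1n D2n ED]]] := join _ _ c1W c2W (EC _ _ c1C c2C).
have dC' x : x \in C1 -> x \in C2 -> False.
  by move=> x1 x2; move/pred0P: dC => /(_ x) /=; rewrite x1 x2.
have cD : c \in D1 :|: D2.
  rewrite eD !inE cc1 /=; apply/andP; split; last by case: (CW c); rewrite ?cC.
  by apply/eqP => e; apply: (dC' c) => //; rewrite e.
wlog cD1 : D1 D2 eD dD D1n D2n ED cD / c \in D1.
  move=> H; case/setUP: (cD) => cD'; first exact: (H D1 D2).
  apply: (H D2 D1) => //; rewrite 1?setUC 1?disjoint_sym // => x y xC yC.
  by rewrite E_sym ED.
have D2C x : x \in D2 -> x \in C2.
  move=> xD; rewrite -(NC2 _ cC) inE ED // andbT.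
  have : x \in D1 :|: D2 by rewrite inE xD orbT.
  by rewrite eD !inE => /and3P[].
have notC x : x \in W :\ c1 :\ c2 -> x \notin C2 -> x \in D1.
  by rewrite -eD inE => /orP[//|/D2C->].
have /set0Pn[d dD2] := D2n; have dC2 := D2C _ dD2.
have sub : u |: (w |: C1) \subset N W d.
  rewrite !subUset !sub1set C1N // andbT !inE uW wW /=.
  apply/andP; split; rewrite E_sym; apply: ED => //; apply: notC.
  - rewrite !inE uW andbT; apply/andP; split.
      by apply/eqP => e; case: (CW c2); rewrite ?c2C ?orbT // -e eqxx.
    by apply/eqP => e; case: (CW c1); rewrite ?c1C // -e eqxx.
  - by apply/negP => uC; case: (CW u); rewrite ?uC ?orbT // eqxx.
  - rewrite !inE wW andbT; apply/andP; split.
      by apply/eqP => e; case: (CW c2); rewrite ?c2C ?orbT // -e eqxx.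
    by apply/eqP => e; case: (CW c1); rewrite ?c1C // -e eqxx.
  - by apply/negP => wC; case: (CW w); rewrite ?wC ?orbT // eqxx.
have uC : u \notin C1 by apply/negP => uC; case: (CW u); rewrite ?uC // eqxx.
have wC : w \notin C1 by apply/negP => wC; case: (CW w); rewrite ?wC // eqxx.
have dW : d \in W by case: (CW d); rewrite ?dC2 ?orbT.
have : #|C1|.+2 < b.
  apply: leq_ltn_trans (deg _ dW); apply: leq_trans (subset_leq_card sub).
  by rewrite !cardsU1 wC !inE eq_sym (negPf wu) uC.
move: p3 b34; clear; slia.
Qed.

(** While c > 2 any step will do, as it lowers c by at most 1; once c = 2, only
single deletions are made, and the previous lemma ensures that there is one. *)
Lemma nonacyclic_bounded_deg b W c : 3 <= b <= 4 -> nz W c -> 2 <= c -> b <= #|W| - c ->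
  (forall u, u \in W -> #|N W u| < b) ->
  exists U c', [/\ nz U c', #|U| = b + c' & 2 <= c'].
Proof.
move=> b34; elim: {W}_.+1 {-2}W c (ltnSn #|W|) => // k IH W c kW h c2 bW deg.
have [e|ne] := eqVneq #|W| (b + c); first by exists W, c; split => //.
have W0 : W != set0 by rewrite -card_gt0; slia.
have rec W' c' : W' \subset W -> nz W' c' -> 2 <= c' -> #|W'| < #|W| -> b <= #|W'| - c' ->
    exists U c', [/\ nz U c', #|U| = b + c' & 2 <= c'].
  move=> W'W h' c2' lt b'; apply: (IH W' c') => //; first by slia.
  move=> u uW; apply: leq_ltn_trans (deg u (subsetP W'W _ uW)).
  exact: subset_leq_card (nbrsS _ _).
have single v : v \in W -> nz (W :\ v) c -> exists U c', [/\ nz U c', #|U| = b + c' & 2 <= c'].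
  move=> vW h1; have e := card_rem vW.
  by apply: (rec (W :\ v) c) => //; rewrite ?subsetDl //; slia.
have [c3|c3] := ltnP 2 c.
  case: (nonacyclic_down1 h W0) => [[v vW h1]|[W1 W1W [e c0 h1]]]; first exact: single h1.
  by apply: (rec W1 c.-1) => //; slia.
have ec : c = 2 by slia.
case: (classic (exists2 v, v \in W & nz (W :\ v) c)) => [[v vW h1]|nv]; first exact: single h1.
rewrite ec in h bW ne nv; case: (nonacyclic_cycle_deg b34 h) => //; last by slia.
by move=> v vW h1; apply: nv; exists v.
Qed.

(** If every single deletion fails and a vertex has m neighbours, its star with
m leaves does everything in one step. Otherwise all degrees are less than m <=
b. This excludes c = 1, where the graph is a join of i + 1 vertices, and c >= 2
is the previous lemma. *)
Lemma nonacyclic_down_one b m W c : 3 <= b <= 4 -> m <= b -> nz W c -> b + m <= #|W| - c ->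
  (exists W' c', [/\ nz W' c', #|W'| + c + m = #|W| + c' & c <= c' + 1]) \/
  (exists U c', [/\ nz U c', #|U| = b + c' & 2 <= c']).
Proof.
move=> b34; elim: m W c => [|m IH] W c mb h mW; first by left; exists W, c; split => //; slia.
case: (classic (exists2 v, v \in W & nz (W :\ v) c)) => [[v vW h1]|nv].
  have e := card_rem vW.
  have [||[W' [c' [? ? ?]]]|] := IH _ _ _ h1; [slia|slia|left|by right].
  by exists W', c'; split => //; slia.
have [/exists_inP[u uW du]|/exists_inPn deg] := boolP [exists u in W, m < #|N W u|].
  case: (nonacyclic_remove_or_star h uW _ du) => // [[W1 W1W [e c0 h1]]].
  by left; exists W1, c.-1; split => //; slia.
right; have {}deg u : u \in W -> #|N W u| <= m by move=> /deg; rewrite -leqNgt.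
apply: (nonacyclic_bounded_deg b34 h); [|slia|by move=> u /deg; slia].
have W0 : W != set0 by rewrite -card_gt0; slia.
have c0 := nonacyclic_gt0 h W0; rewrite ltn_neqAle c0 andbT; apply/eqP => c1.
rewrite -c1 in h; have [C1 [C2 [eC dC C1n C2n EC]]] := nonacyclic1 E_sym E_irr h.
have := leq_card_setU C1 C2; case=> _; rewrite dC eC => /eqP WC.
have /set0Pn[x xC] := C1n; have /set0Pn[y yC] := C2n.
have xW : x \in W by rewrite -eC inE xC.
have yW : y \in W by rewrite -eC inE yC orbT.
have : #|C2| <= #|N W x|.
  apply: subset_leq_card; apply/subsetP => z zC.
  by rewrite inE EC // andbT -eC inE zC orbT.
have : #|C1| <= #|N W y|.
  apply: subset_leq_card; apply/subsetP => z zC.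
  by rewrite inE E_sym EC // andbT -eC inE zC.
have := deg _ xW; have := deg _ yW; slia.
Qed.

End Combinatorics.

(** * The Koszul complex in each multidegree *)

Section KoszulPoly.
Local Open Scope ring_scope.
Variables (K : fieldType) (n : nat).
Local Notation S := {mpoly K[n]}.
Implicit Types (B W : {set 'I_n}) (k : 'I_n) (m mu : 'X_{1..n}) (z w : {set 'I_n} -> S).

Definition mset B : 'X_{1..n} := [multinom (i \in B : nat) | i < n].

Lemma msetE B i : mset B i = (i \in B).
Proof. by rewrite mnmE. Qed.

Lemma mdeg_mset B : mdeg (mset B) = #|B|.
Proof. by rewrite mdegE -[RHS]sum1_card [RHS]big_mkcond; apply: eq_bigr => i _; rewrite msetE; case: ifP. Qed.

Lemma mset_le B mu : reflect (forall i, i \in B -> (0 < mu i)%N) (mset B <= mu)%MM.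
Proof.
apply: (iffP mnm_lepP) => h i; first by move=> iB; move: (h i); rewrite msetE iB.
by rewrite msetE; case: (boolP (i \in B)) => // /h.
Qed.

Lemma card_compl B p : (#|B| + p = n)%N -> #|~: B| = p.
Proof. by move=> h; apply: (@addnI #|B|); rewrite cardsC card_ord h. Qed.

Lemma setC_D1 B k : ~: (B :\ k) = k |: ~: B.
Proof. by rewrite setCD setUC. Qed.

Lemma mset_leD1 B k mu :  k \in B ->
  (mset (~: (B :\ k)) <= mu)%MM = ((0 < mu k)%N && (mset (~: B) <= mu)%MM).
Proof.
move=> kB; rewrite setC_D1; apply/mset_le/andP => [h|[muk /mset_le h] i].
  by split; [apply: h; rewrite setU11 | apply/mset_le => i iB; apply: h; rewrite setU1r].
by case/setU1P => [->|/h].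
Qed.

Lemma mset_D1 B k : k \in B -> mset (~: (B :\ k)) = (mset (~: B) + U_(k))%MM.
Proof.
move=> kB; apply/mnmP => i; rewrite mnmDE !msetE mnm1E setC_D1 !inE.
by case: eqVneq => [->|_]; rewrite ?kB ?addn0.
Qed.

Lemma mcoeff_sgn k B (p : S) m : (sgn S k B * p)@_m = sgn K k B * p@_m.
Proof. by rewrite /sgn -signr_odd -[in RHS]signr_odd !mulr_sign; case: odd; rewrite ?mcoeffN. Qed.

Lemma mcoeffXM k (p : S) m :
  ('X_k * p)@_m = if (0 < m k)%N then p@_(m - U_(k)) else 0.
Proof.
rewrite mulrC; case: ifPn => [mk|mk].
  rewrite -{1}(@submK _ U_(k)%MM m) ?lep1mP -?lt0n // addmC mcoeffMX //.
apply/eqP; rewrite mcoeff_eq0 (perm_mem (msuppMX _ _)); apply/mapP => -[m' _ e].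
by move: mk; rewrite e mnmDE mnm1E eqxx.
Qed.

(** The multidegree of a monomial m at the index B is m + mset (~: B): the
elements of ~: B stand for exterior factors. This is the part of z in
multidegree mu, seen as a K-valued cochain. *)
Definition mpart mu z B : K :=
  if (mset (~: B) <= mu)%MM then (z B)@_(mu - mset (~: B)) else 0.

Lemma mpart_mcoeff z B m : (z B)@_m = mpart (m + mset (~: B))%MM z B.
Proof. by rewrite /mpart lem_addl addmK. Qed.

Definition koszX z B := kosz (fun k => 'X_k : S) z B.
Definition kosz1 (f : {set 'I_n} -> K) B := kosz (fun=> 1) f B.

Lemma mpart_kosz mu z B : mpart mu (koszX z) B = kosz1 (mpart mu z) B.
Proof.
rewrite /mpart /koszX /kosz1 /kosz; case: ifPn => le.
  rewrite raddf_sum /=; apply: eq_bigr => k kB.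
  rewrite -mulrA mcoeff_sgn mcoeffXM mulr1 mset_leD1 // le andbT.
  have -> : (mu - mset (~: B))%MM k = mu k by rewrite mnmBE msetE in_setC kB subn0.
  have -> : (mu - mset (~: (B :\ k)))%MM = (mu - mset (~: B) - U_(k))%MM.
    by rewrite mset_D1 //; apply/mnmP => i; rewrite !mnmBE mnmDE subnDA.
  by case: ifP.
by rewrite big1 // => k kB; rewrite mset_leD1 // (negPf le) andbF mulr0.
Qed.

(** Elements of exterior degree p and total degree j with coefficients in a free
module of rank one generated in degree s. *)
Definition homog_family j s p z :=
  forall B m, (z B)@_m != 0 -> (#|B| + p = n)%N /\ (mdeg m + s + p = j)%N.

Lemma homog_family_mpart j s p z mu B : homog_family j s p z -> mpart mu z B != 0 ->
  [/\ (#|B| + p = n)%N, (mdeg mu + s = j)%N & (mset (~: B) <= mu)%MM].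
Proof.
rewrite /mpart => hz; case: ifPn => le; last by rewrite eqxx.
move=> /hz[cB h]; split => //; rewrite -h -(submK le) mdegD mdeg_mset submK //.
by rewrite (card_compl cB) addnAC.
Qed.

Lemma homog_family_of_mpart j s p z :
  (forall mu B, mpart mu z B != 0 -> (#|B| + p = n)%N /\ (mdeg mu + s = j)%N) ->
  homog_family j s p z.
Proof.
move=> h B m; rewrite mpart_mcoeff => /h[cB <-]; split => //.
rewrite mdegD mdeg_mset; by rewrite (card_compl cB) addnAC.
Qed.

Lemma homog_family_kosz j s p z : homog_family j s p.+1 z -> homog_family j s p (koszX z).
Proof.
move=> hz; apply: homog_family_of_mpart => mu B; rewrite mpart_kosz => h.
have [k kB] : exists2 k, k \in B & mpart mu z (B :\ k) != 0.
  apply/exists_inP; apply: contraNT h; rewrite negb_exists_in => /forall_inP h.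
  by apply/eqP/big1 => k /h; rewrite negbK => /eqP->; rewrite mulr0.
by move=> /(homog_family_mpart hz)[c d _]; rewrite -(card_rem kB) addSnnS.
Qed.

Definition mpoly_lt d (c : 'X_{1..n} -> K) : S :=
  \sum_(m : 'X_{1..n < d}) c m *: 'X_[m].

Lemma mcoeff_lt d c m : (mpoly_lt d c)@_m = if (mdeg m < d)%N then c m else 0.
Proof.
rewrite /mpoly_lt; case: ltnP => md; first exact: mcoeff_mpoly.
rewrite raddf_sum big1 //= => m' _; rewrite mcoeffZ mcoeffX (_ : _ == m = false) ?mulr0 //.
by apply/eqP => e; have := bmdeg m'; rewrite e ltnNge md.
Qed.

(** The family of exterior degree p whose part in each multidegree mu of degree
j - s is b mu. *)
Definition assemble j s p (b : 'X_{1..n} -> {set 'I_n} -> K) B : S :=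
  if (#|B| + p == n)%N then
    mpoly_lt j.+1 (fun m => if (mdeg m + s + p == j)%N then b (m + mset (~: B))%MM B else 0)
  else 0.

Lemma mcoeff_assemble j s p b B m : (assemble j s p b B)@_m =
  if (#|B| + p == n)%N && (mdeg m + s + p == j)%N then b (m + mset (~: B))%MM B else 0.
Proof.
rewrite /assemble; case: ifP => _ /=; last by rewrite mcoeff0.
by rewrite mcoeff_lt; case: ltnP => //; case: eqP => // <-; rewrite ltnNge -addnA leq_addr.
Qed.

Lemma homog_family_assemble j s p b : homog_family j s p (assemble j s p b).
Proof. by move=> B m; rewrite mcoeff_assemble; case: ifP => [/andP[/eqP ? /eqP ?]|]; rewrite ?eqxx. Qed.

(** Modulo the monomials outside N, the equation z = d w can be solved in each
multidegree separately. *)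
Lemma koszul_solve (N : pred 'X_{1..n}) j s p z : homog_family j s p z ->
  (forall mu, (mdeg mu + s = j)%N -> exists b : {set 'I_n} -> K,
     (forall B, ~~ (mset (~: B) <= mu)%MM -> b B = 0) /\
     (forall B, (#|B| + p = n)%N -> (mset (~: B) <= mu)%MM -> N (mu - mset (~: B))%MM ->
       mpart mu z B = kosz1 b B)) ->
  exists2 w, homog_family j s p.+1 w & forall B m, N m -> (z B)@_m = (koszX w B)@_m.
Proof.
move=> hz solve.
have /functional_choice[b hb] : forall mu, exists b : {set 'I_n} -> K, (mdeg mu + s = j)%N ->
     (forall B, ~~ (mset (~: B) <= mu)%MM -> b B = 0) /\
     (forall B, (#|B| + p = n)%N -> (mset (~: B) <= mu)%MM -> N (mu - mset (~: B))%MM ->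
       mpart mu z B = kosz1 b B).
  move=> mu; have [e|ne] := eqVneq (mdeg mu + s)%N j; first by have [b ?] := solve mu e; exists b.
  by exists (fun=> 0) => e; rewrite e eqxx in ne.
pose w := assemble j s p.+1 b; have fw : homog_family j s p.+1 w by apply: homog_family_assemble.
exists w => // B m Nm; rewrite !mpart_mcoeff; set mu := (m + _)%MM.
have le : (mset (~: B) <= mu)%MM by rewrite lem_addl.
have [/andP[/eqP cB /eqP e]|ne] := boolP ((#|B| + p == n)%N && (mdeg mu + s == j)%N).
  have [b0 bE] := hb mu e; rewrite mpart_kosz (bE B) ?addmK //.
  apply: eq_kosz => k kB; rewrite /mpart; case: ifPn => le'; last exact: b0.
  have eB : (#|B :\ k| + p.+1)%N = n by rewrite -addSnnS card_rem.
  rewrite mcoeff_assemble eB eqxx submK //= ifT //; apply/eqP.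
  move: e; rewrite -{1}(submK le') mdegD mdeg_mset.
  by rewrite (card_compl eB) addnAC.
have zero z' : homog_family j s p z' -> mpart mu z' B = 0.
  move=> hz'; apply/eqP; apply: contraNT ne => /(homog_family_mpart hz')[-> -> _].
  by rewrite !eqxx.
by rewrite !zero //; apply: homog_family_kosz.
Qed.

Lemma contract_support mu (f : {set 'I_n} -> K) k B : (0 < mu k)%N ->
  (forall B, ~~ (mset (~: B) <= mu)%MM -> f B = 0) ->
  ~~ (mset (~: B) <= mu)%MM -> contract k f B = 0.
Proof.
move=> muk f0 nle; rewrite /contract; case: ifPn => // kB; rewrite f0 ?mulr0 //.
by apply: contra nle => le; rewrite -[B in mset (~: B)](setU1K kB) mset_leD1 ?setU11 // muk le.
Qed.

Lemma mpart_support mu z B : ~~ (mset (~: B) <= mu)%MM -> mpart mu z B = 0.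
Proof. by rewrite /mpart => /negPf->. Qed.

(** In a nonzero multidegree mu, contraction with any k in the support of mu is
a contracting homotopy. *)
Lemma koszul_exact j s p z : homog_family j s p z -> (forall B, koszX z B = 0) -> (z setT)@_0 = 0 ->
  exists2 w, homog_family j s p.+1 w & forall B, z B = koszX w B.
Proof.
move=> hz z0 zT; have [|w hw e] := @koszul_solve predT _ _ _ _ hz; last first.
  by exists w => // B; apply/mpolyP => m; apply: e.
move=> mu _; have [->|mu0] := eqVneq mu 0%MM.
  exists (fun=> 0); split => // B _ le _; rewrite /kosz1 /kosz big1 => [|k _]; last by rewrite mulr0.
  rewrite /mpart le; have BT : B = setT.
    apply/setP => i; rewrite inE; apply/negPn/negP => iB; have /mset_le/(_ i) := le.
    by rewrite inE iB mnm0E => /(_ isT).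
  rewrite BT (_ : _ - _ = 0)%MM //; apply/mnmP => i; by rewrite mnmBE !mnm0E.
have [k muk] : exists k, (0 < mu k)%N.
  apply/existsP; apply: contraNT mu0 => /existsPn h; apply/eqP/mnmP => i.
  by have := h i; rewrite -eqn0Ngt mnm0E => /eqP.
exists (contract k (mpart mu z)); split=> [B|B _ _ _].
  by apply: contract_support => //; apply: mpart_support.
have := kosz_homotopy (fun=> 1) k (mpart mu z) B; rewrite mul1r => <-.
rewrite [X in _ + X](_ : _ = 0) ?addr0 // /contract; case: ifP => // _.
by have := mpart_kosz mu z (k |: B); rewrite /kosz1 => <-; rewrite /mpart z0 mcoeff0 if_same mulr0.
Qed.

End KoszulPoly.

(** * Cycles in a double complex *)

Section DoubleComplex.
Local Open Scope ring_scope.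
Variables (V : nat -> nat -> zmodType) (P : forall p q, V p q -> Prop).
Variables (d : forall p q, V p q.+1 -> V p q) (k : forall p q, V p.+1 q -> V p q).
Arguments P {p q}. Arguments d {p q}. Arguments k {p q}.
Hypotheses (PB : forall p q (x y : V p q), P x -> P y -> P (x - y)).
Hypotheses (dP : forall p q (x : V p q.+1), P x -> P (d x)) (kP : forall p q (x : V p.+1 q), P x -> P (k x)).
Hypotheses (dD : forall p q (x y : V p q.+1), d (x + y) = d x + d y).
Hypotheses (kD : forall p q (x y : V p.+1 q), k (x + y) = k x + k y).
Hypotheses (dd : forall p q (x : V p q.+2), d (d x) = 0) (kk : forall p q (x : V p.+2 q), k (k x) = 0).
Hypothesis dk : forall p q (x : V p.+1 q.+1), d (k x) = k (d x).
Hypothesis exact_d : forall p q (x : V p q.+1), P x -> d x = 0 -> exists2 y : V p q.+2, P y & x = d y.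
Hypothesis exact_k : forall p q (x : V p.+1 q), P x -> k x = 0 -> exists2 y : V p.+2 q, P y & x = k y.

Definition nonboundary p q (z : V p q) :=
  forall (u : V p.+1 q) (v : V p q.+1), P u -> P v -> z <> k u + d v.

(** One step replaces z by y with k z = d y. If y were a boundary k u + d v,
then z - d u would be killed by k, hence of the form k t, and z would be a
boundary. *)
Lemma zigzag p q r (z : V p.+1 q) : r = (p + q)%N -> P z -> nonboundary z ->
  (exists2 y : V p q.+1, P y & k z = d y) ->
  exists z' : V 0 r.+1, [/\ P z', nonboundary z' & exists2 y : V 1 r, P y & d z' = k y].
Proof.
have kB p' q' (x y : V p'.+1 q') : k (x - y) = k x - k y.
  by have := kD (x - y) y; rewrite subrK => ->; rewrite addrK.
elim: p q z => [|p IH] q z er Pz nz [y Py zy].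
all: have ny : nonboundary y.
1,3: move=> u v Pu Pv ye; have : k (z - d u) = 0 by rewrite kB zy ye dD dd addr0 dk subrr.
1,2: by case/exact_k => [|t Pt e]; [apply: PB => //; apply: dP | apply: (nz t u) => //; rewrite -e subrK].
  by rewrite er; exists y; split => //; exists z.
apply: (IH q.+1 y) => //; first by rewrite er addSnnS.
have : d (k y) = 0 by rewrite dk -zy kk.
by case/exact_d => [|t Pt e]; [apply: kP | exists t].
Qed.

End DoubleComplex.

(** * The double complex of a resolution and the Koszul complex *)

Section EdgeIdeal.
Local Open Scope ring_scope.
Variables (K : fieldType) (n : nat) (E : rel 'I_n).
Hypothesis E_irr : irreflexive E.
Local Notation S := {mpoly K[n]}.
Local Notation I := (@edge_ideal K n E).
Implicit Types (m : 'X_{1..n}) (B W : {set 'I_n}).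

(** The standard monomials, which form a basis of S/I. *)
Definition standard m := ~~ [exists i, exists j, [&& E i j, (0 < m i)%N & (0 < m j)%N]].

Lemma edge_idealP (p : S) : I p <-> forall m, standard m -> p@_m = 0.
Proof.
split=> [[c ->] m sm|h].
  rewrite raddf_sum big1 //= => i _; rewrite raddf_sum big1 //= => j Eij.
  rewrite mulrC -mulrA !mcoeffXM; case: ifP => // mi; case: ifP => // mj.
  case/negP: sm; apply/existsP; exists i; apply/existsP; exists j; rewrite Eij mi /=.
  by move: mj; rewrite mnmBE; lia.
have I0 : I 0.
  by exists (fun _ _ => 0); rewrite big1 // => i _; rewrite big1 // => j _; rewrite mul0r.
have ID p1 p2 : I p1 -> I p2 -> I (p1 + p2).
  case=> c1 -> [c2 ->]; exists (fun i j => c1 i j + c2 i j).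
  rewrite -big_split; apply: eq_bigr => i _; rewrite -big_split; apply: eq_bigr => j _.
  by rewrite mulrDl.
rewrite (mpolyE p) big_seq; apply: (big_ind I) => // m; rewrite mcoeff_msupp => pm.
have : ~~ standard m by apply: contra pm => /h/eqP.
rewrite negbK => /existsP[i /existsP[j /and3P[Eij mi mj]]].
have ij : i != j by apply: contraTneq Eij => ->; rewrite E_irr.
have le : (U_(i) + U_(j) <= m)%MM.
  apply/mnm_lepP => l; rewrite mnmDE !mnm1E; case: (eqVneq i l) => [<-|_].
    by rewrite eq_sym (negPf ij).
  by case: (eqVneq j l) => [<-|_].
exists (fun i' j' => if (i' == i) && (j' == j) then p@_m *: 'X_[m - (U_(i) + U_(j))] else 0).
rewrite (bigD1 i) //= (bigD1 j) //= !eqxx /= -mpolyXD -scalerAl -mpolyXD submK //.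
rewrite big1 => [|j' /andP[_ /negPf->]]; last by rewrite mul0r.
rewrite big1 => [|i' /negPf-> /=]; last by apply: big1 => j' _; rewrite mul0r.
by rewrite !addr0.
Qed.

(** The homogeneous part of degree t, for a generator placed in degree s. *)
Definition hpol t s (p : S) : S := mpoly_lt t.+1 (fun m => if (mdeg m + s == t)%N then p@_m else 0).

Lemma mcoeff_hpol t s (p : S) m : (hpol t s p)@_m = if (mdeg m + s == t)%N then p@_m else 0.
Proof. by rewrite mcoeff_lt; case: ltnP => //; case: eqP => // <-; rewrite ltnNge leq_addr. Qed.

Lemma hpol_id t s (p : S) : (forall m, p@_m != 0 -> (mdeg m + s = t)%N) -> hpol t s p = p.
Proof.
move=> h; apply/mpolyP => m; rewrite mcoeff_hpol; case: eqP => // ne.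
by apply/esym/eqP; apply/negP => /negP/h.
Qed.

Lemma hpol_mul t s s' (p g : S) : (forall m, g@_m != 0 -> (mdeg m + s' = s)%N) ->
  hpol t s p * g = hpol t s' (p * g).
Proof.
move=> h; apply/mpolyP => m; rewrite mcoeff_hpol !mcoeffM.
have -> (b : bool) (x : K) : (if b then x else 0) = b%:R * x by case: b; rewrite ?mul1r ?mul0r.
rewrite mulr_sumr; apply: eq_bigr => -[k1 k2] /= /eqP/(congr1 (@mdeg n)) em; rewrite mcoeff_hpol.
have [->|/h hs] := eqVneq (g@_k2) 0; first by rewrite !mulr0.
have -> : (mdeg m + s' == t)%N = (mdeg k1 + s == t)%N.
  by congr (_ == t); move: em; rewrite mdegD -hs; lia.
by case: ifP => _; rewrite ?mul1r // !mul0r.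
Qed.

Definition hrow r t (sh : 'I_r -> nat) (v : 'rV[S]_r) : 'rV[S]_r :=
  \row_l hpol t (sh l) (v 0 l).

Lemma hpol_sum (T : finType) t s (f : T -> S) : hpol t s (\sum_x f x) = \sum_x hpol t s (f x).
Proof.
apply/mpolyP => m; rewrite mcoeff_hpol !raddf_sum /=; under [RHS]eq_bigr do rewrite mcoeff_hpol.
by case: ifP => _ //; rewrite big1.
Qed.

Lemma hrow_mul r r' t (sh : 'I_r -> nat) (sh' : 'I_r' -> nat) (M : 'M[S]_(r, r')) v :
  (forall k l m, (M k l)@_m != 0 -> (mdeg m + sh' l = sh k)%N) ->
  hrow t sh v *m M = hrow t sh' (v *m M).
Proof.
move=> h; apply/rowP => l; rewrite !mxE hpol_sum; apply: eq_bigr => k _.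
by rewrite mxE (@hpol_mul _ _ (sh' l)) // => m; apply: h.
Qed.

Variable F : resolution I.
Variable j : nat.

(** Elements of Koszul_p (x) F_q, given at each B by a vector of F_q. The type
does not depend on p: the exterior degree and the total degree j are imposed by
[graded]. *)
Definition chain (p q : nat) : zmodType := {ffun {set 'I_n} -> 'rV[S]_(rk F q)}.

Definition component p q (z : chain p q) l B : S := z B 0 l.

Definition graded p q (z : chain p q) : Prop := forall l, homog_family j (shift F q l) p (component z l).

Definition dF p q (z : chain p q.+1) : chain p q := [ffun B => z B *m diff F q].

Definition kF p q (z : chain p.+1 q) : chain p q := [ffun B => \row_l koszX (component z l) B].

Definition augF p (z : chain p 0) B : S := (z B *m aug F) 0 0.

Lemma component_kF p q (z : chain p.+1 q) l B : component (kF z) l B = koszX (component z l) B.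
Proof. by rewrite /component ffunE mxE. Qed.

Lemma chainP p q (x y : chain p q) : (forall l B, component x l B = component y l B) -> x = y.
Proof. by move=> h; apply/ffunP => B; apply/rowP => l; apply: h. Qed.

Lemma koszX_mulmx p q r (z : chain p q) (M : 'M[S]_(rk F q, r)) l B :
  koszX (fun B => (z B *m M) 0 l) B = \sum_k koszX (component z k) B * M k l.
Proof.
rewrite /koszX; transitivity (kosz (fun k => 'X_k : S) (fun B => \sum_k z B 0 k * M k l) B).
  by apply: eq_kosz => k _; rewrite mxE.
by rewrite kosz_sum; apply: eq_bigr => k _; rewrite koszMr.
Qed.

Lemma dF_kF p q (x : chain p.+1 q.+1) : dF (kF x) = kF (dF x).
Proof.
apply: chainP => l B; rewrite component_kF {1}/component ffunE mxE.
transitivity (koszX (fun B => (x B *m diff F q) 0 l) B); last first.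
  by apply: eq_kosz => k _; rewrite /component ffunE.
by rewrite koszX_mulmx; apply: eq_bigr => k _; rewrite ffunE mxE.
Qed.

Lemma diff_deg q k l m : (diff F q k l)@_m != 0 -> (mdeg m + shift F q l = shift F q.+1 k)%N.
Proof. by rewrite -mcoeff_msupp => /diff_homog. Qed.

Lemma aug_deg k m : (aug F k 0)@_m != 0 -> (mdeg m + 0 = shift F 0 k)%N.
Proof. by rewrite addn0 -mcoeff_msupp; move/dhomogP: (aug_homog k); apply. Qed.

Lemma gradedB p q (x y : chain p q) : graded x -> graded y -> graded (x - y).
Proof.
move=> hx hy l B m; rewrite /component !ffunE !mxE mcoeffB.
have [x0|/hx//] := eqVneq (x B 0 l)@_m 0.
have [y0|/hy//] := eqVneq (y B 0 l)@_m 0.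
by rewrite x0 y0 subrr eqxx.
Qed.

Lemma mulmx_deg p q r (z : chain p q) (M : 'M[S]_(rk F q, r)) (sh : 'I_r -> nat) : graded z ->
  (forall k l m, (M k l)@_m != 0 -> (mdeg m + sh l = shift F q k)%N) ->
  forall l, homog_family j (sh l) p (fun B => (z B *m M) 0 l).
Proof.
move=> hz hM l B m; rewrite mxE raddf_sum /= => ne.
have [k] : exists k, (z B 0 k * M k l)@_m != 0.
  apply/existsP; apply: contraNT ne => /existsPn h; apply/eqP/big1 => k _.
  by apply/eqP; rewrite -[_ == _]negbK h.
rewrite mcoeffM => {}ne.
have [[k1 k2] /= /andP[/eqP/(congr1 (@mdeg n)) em ne']] : exists x : 'X_{1..n < (mdeg m).+1, (mdeg m).+1},
   (m == x.1 + x.2)%MM && ((z B 0 k)@_x.1 * (M k l)@_x.2 != 0).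
  apply/existsP; apply: contraNT ne => /existsPn h; apply/eqP/big1 => x ex.
  by apply/eqP; move: (h x); rewrite ex /= negbK.
move: ne'; rewrite mulf_eq0 negb_or => /andP[/hz[cB e1] /hM e2]; split => //.
by move: em; rewrite mdegD; lia.
Qed.

Lemma graded_dF p q (x : chain p q.+1) : graded x -> graded (dF x).
Proof.
move=> hx l B m; rewrite /component ffunE.
exact: (mulmx_deg (M := diff F q) (sh := shift F q) hx (@diff_deg q)).
Qed.

Lemma homog_family_augF p (x : chain p 0) : graded x -> homog_family j 0 p (augF x).
Proof.
move=> hx; apply: (mulmx_deg (M := aug F) (sh := fun=> 0%N) hx) => k l m.
by rewrite ord1; apply: aug_deg.
Qed.

Lemma graded_kF p q (x : chain p.+1 q) : graded x -> graded (kF x).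
Proof.
by move=> hx l B m; rewrite component_kF; apply: (homog_family_kosz (hx l)).
Qed.

Lemma dFD p q (x y : chain p q.+1) : dF (x + y) = dF x + dF y.
Proof. by apply/ffunP => B; rewrite !ffunE mulmxDl. Qed.

Lemma kFD p q (x y : chain p.+1 q) : kF (x + y) = kF x + kF y.
Proof.
apply: chainP => l B; rewrite component_kF {2}/component !ffunE !mxE -koszD.
by apply: eq_kosz => k _; rewrite /component !ffunE !mxE.
Qed.

Lemma kF_kF p q (x : chain p.+2 q) : kF (kF x) = 0.
Proof.
apply: chainP => l B; rewrite component_kF [RHS]/component ffunE mxE.
rewrite /koszX -[RHS](kosz_kosz (fun k => 'X_k) (component x l) B).
by apply: eq_kosz => k _; rewrite component_kF.
Qed.

Lemma diff_diff q : diff F q.+1 *m diff F q = 0.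
Proof.
apply/row_matrixP => k; rewrite row0 rowE mulmxA; apply/exactS.
by exists (delta_mx 0 k).
Qed.

Lemma dF_dF p q (x : chain p q.+2) : dF (dF x) = 0.
Proof. by apply/ffunP => B; rewrite !ffunE -mulmxA diff_diff mulmx0. Qed.

(** Since M preserves degrees, a lift through M may be replaced by its
homogeneous part. *)
Lemma graded_lift p q r (M : 'M[S]_(rk F q, r)) (sh : 'I_r -> nat) (Q : {set 'I_n} -> 'rV[S]_r -> Prop)
  (hM : forall k l m, (M k l)@_m != 0 -> (mdeg m + sh l = shift F q k)%N) :
  (forall B : {set 'I_n}, (#|B| + p = n)%N -> exists w : 'rV_(rk F q), Q B (w *m M)) ->
  exists2 y : chain p q, graded y &
    forall B : {set 'I_n}, (#|B| + p = n)%N -> exists2 x, Q B x & y B *m M = hrow j (fun l => sh l + p)%N x.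
Proof.
move=> h.
have /functional_choice[w hw] : forall B, exists w : 'rV_(rk F q), (#|B| + p = n)%N -> Q B (w *m M).
  move=> B; case: (eqVneq (#|B| + p)%N n) => [e|ne]; first by have [w ?] := h B e; exists w.
  by exists 0 => e; rewrite e eqxx in ne.
exists [ffun B : {set 'I_n} => if (#|B| + p == n)%N then hrow j (fun l => shift F q l + p)%N (w B) else 0].
  move=> l B m; rewrite /component ffunE; have [e|_] := eqVneq (#|B| + p)%N n; last by rewrite mxE mcoeff0 eqxx.
  by rewrite mxE mcoeff_hpol addnA; have [->|] := eqVneq (mdeg m + _ + p)%N j; rewrite ?eqxx.
move=> B e; rewrite ffunE e eqxx; exists (w B *m M); first exact: hw.
by apply: hrow_mul => k l m /hM <-; rewrite addnA.
Qed.

Lemma hrow_graded p q (x : chain p q) B : graded x -> (#|B| + p = n)%N ->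
  hrow j (fun l => shift F q l + p)%N (x B) = x B.
Proof.
move=> hx e; apply/rowP => l; rewrite mxE; apply: hpol_id => m /hx[_ <-]; by rewrite addnA.
Qed.

Lemma graded0 p q (x : chain p q) B : graded x -> (#|B| + p)%N <> n -> x B = 0.
Proof.
move=> hx ne; apply/rowP => l; apply/mpolyP => m; rewrite mxE mcoeff0; apply/eqP.
by apply/negP => /negP/hx[].
Qed.

Lemma exact_dF p q (x : chain p q.+1) : graded x -> dF x = 0 -> exists2 y : chain p q.+2, graded y & x = dF y.
Proof.
move=> hx x0.
have [|y hy e] := @graded_lift p q.+2 _ (diff F q.+1) (shift F q.+1) (fun B v => v = x B) (@diff_deg _).
  move=> B _; have [w e] : exists w, x B = w *m diff F q.+1.
    by apply/exactS; move/ffunP: x0 => /(_ B); rewrite !ffunE.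
  by exists w.
exists y => //; apply/ffunP => B; rewrite ffunE.
have [eB|/eqP nB] := eqVneq (#|B| + p)%N n; last by rewrite !(graded0 _ nB) // mul0mx.
by have [_ -> ->] := e B eB; rewrite hrow_graded.
Qed.

Lemma exact_augF p (x : chain p 0) : graded x -> (forall B, I (augF x B)) ->
  exists2 y : chain p 1, graded y & x = dF y.
Proof.
move=> hx x0.
have [|y hy e] := @graded_lift p 1 _ (diff F 0) (shift F 0) (fun B v => v = x B) (@diff_deg _).
  move=> B _; have [w e] : exists w, x B = w *m diff F 0 by apply/exact0; apply: x0.
  by exists w.
exists y => //; apply/ffunP => B; rewrite ffunE.
have [eB|/eqP nB] := eqVneq (#|B| + p)%N n; last by rewrite !(graded0 _ nB) // mul0mx.
by have [_ -> ->] := e B eB; rewrite hrow_graded.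
Qed.

Lemma augF_dF p (y : chain p 1) B : I (augF (dF y) B).
Proof. by apply/exact0; exists (y B); rewrite ffunE. Qed.

Lemma augF_surj p (f : {set 'I_n} -> S) : homog_family j 0 p f ->
  exists2 z : chain p 0, graded z & forall B m, standard m -> (f B)@_m = (augF z B)@_m.
Proof.
move=> hf.
have deg k (l : 'I_1) m : (aug F k l)@_m != 0 -> (mdeg m + 0 = shift F 0 k)%N.
  by rewrite ord1; apply: aug_deg.
have [|z hz e] := @graded_lift p 0 _ (aug F) (fun=> 0%N) (fun B v => I (f B - v 0 0)) deg.
  by move=> B _; have [w hw] := aug_surj F (f B); exists w.
exists z => // B m sm; have [eB|/eqP nB] := eqVneq (#|B| + p)%N n; last first.
  rewrite /augF (graded0 hz nB) mul0mx mxE mcoeff0; apply/eqP.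
  by apply/negP => /negP/hf[].
have [x /edge_idealP hx ex] := e B eB.
rewrite /augF ex mxE mcoeff_hpol; have := hx m sm; rewrite mcoeffB => /eqP; rewrite subr_eq0 => /eqP <-.
case: eqP => // ne; apply/eqP; apply/negP => /negP/hf[_]; by rewrite addnA in ne.
Qed.

Lemma exact_kF p q (x : chain p q) : graded x -> (forall l B, koszX (component x l) B = 0) ->
  (forall l, (component x l setT)@_0 = 0) -> exists2 y : chain p.+1 q, graded y & x = kF y.
Proof.
move=> hx x0 xT.
have /functional_choice[w hw] : forall l, exists w : {set 'I_n} -> S,
    homog_family j (shift F q l) p.+1 w /\ forall B, component x l B = koszX w B.
  by move=> l; have [w ? ?] := koszul_exact (hx l) (x0 l) (xT l); exists w.
exists [ffun B => \row_l w l B].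
  by move=> l B m; rewrite /component ffunE mxE; case: (hw l) => h _; apply: h.
apply: chainP => l B; rewrite component_kF; case: (hw l) => _ ->.
by apply: eq_kosz => k _; rewrite /component ffunE mxE.
Qed.

Lemma exact_kFS p q (x : chain p.+1 q) : graded x -> kF x = 0 ->
  exists2 y : chain p.+2 q, graded y & x = kF y.
Proof.
move=> hx x0; apply: exact_kF => // [l B|l]; first by rewrite -component_kF x0 /component ffunE mxE.
apply/eqP; apply/negP => /negP/hx[]; rewrite cardsT card_ord; lia.
Qed.

Lemma augF_kF p (z : chain p.+1 0) B : augF (kF z) B = koszX (augF z) B.
Proof.
rewrite /augF koszX_mulmx mxE; apply: eq_bigr => k _.
by rewrite ffunE mxE.
Qed.

End EdgeIdeal.

(** * The edge F (x) K *)

Section Tor.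
Local Open Scope ring_scope.
Variables (K : fieldType) (n : nat) (E : rel 'I_n).
Hypothesis E_irr : irreflexive E.
Local Notation S := {mpoly K[n]}.
Local Notation I := (@edge_ideal K n E).
Variable F : resolution I.
Variable j : nat.
Implicit Types (m : 'X_{1..n}) (B W s : {set 'I_n}).
Local Notation chain := (chain F).
Local Notation graded := (graded j).

Definition chain_nonboundary p q (z : chain p q) :=
  forall (u : chain p.+1 q) (v : chain p q.+1), graded u -> graded v -> z <> kF u + dF v.

Definition const_coeffs r c (M : 'M[S]_(r, c)) : 'M[K]_(r, c) := map_mx (mcoeff 0%MM) M.

Lemma const_coeffsM r1 r2 r3 (A : 'M[S]_(r1, r2)) (M : 'M[S]_(r2, r3)) :
  const_coeffs (A *m M) = const_coeffs A *m const_coeffs M.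
Proof. by rewrite /const_coeffs map_mxM. Qed.

Lemma const_coeffs_kF q (u : chain 1 q) B : const_coeffs (kF u B) = 0.
Proof.
apply/rowP => l; rewrite !mxE ffunE mxE /koszX /kosz raddf_sum big1 //= => k _.
by rewrite -mulrA mcoeff_sgn mcoeffXM mnm0E mulr0.
Qed.

Definition constant_chain q (v : 'rV[K]_(rk F q)) : chain 0 q :=
  [ffun B : {set 'I_n} => if B == setT then map_mx (@mpolyC n K) v else 0].

Lemma graded_constant_chain q (v : 'rV[K]_(rk F q)) : (forall l, v 0 l != 0 -> shift F q l = j) ->
  graded (constant_chain v).
Proof.
move=> hv l B m; rewrite /component ffunE; have [->|_] := eqVneq B setT; last by rewrite mxE mcoeff0 eqxx.
rewrite mxE mcoeffC cardsT card_ord addn0; have [->|] := eqVneq m 0%MM; last by rewrite mulr0 eqxx.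
by rewrite mulr1 mdeg0 => /hv ->; split => //; rewrite addn0.
Qed.

Lemma const_coeffs_constant_chain q (v : 'rV[K]_(rk F q)) : const_coeffs (constant_chain v setT) = v.
Proof. by apply/rowP => l; rewrite mxE ffunE eqxx mxE mcoeffC eqxx mulr1. Qed.

Lemma graded_const_coeffs q (z : chain 0 q) B l : graded z -> const_coeffs (z B) 0 l != 0 -> shift F q l = j.
Proof. by move=> hz; rewrite mxE => /hz[_]; rewrite mdeg0 addn0. Qed.

Lemma degree_partP q (v : 'rV[K]_(rk F q)) :
  reflect (forall l, v 0 l != 0 -> shift F q l = j) (v <= degree_part F q j)%MS.
Proof.
apply: (iffP idP) => [/submxP[x ->] l|h].
  by rewrite mul_mx_diag !mxE; have [|] := eqVneq (shift F q l) j; rewrite ?mulr0 ?eqxx.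
have -> : v = v *m degree_part F q j; last exact: submxMl.
apply/rowP => l; rewrite mul_mx_diag !mxE; have [->|/h ->] := eqVneq (v 0 l) 0.
  by rewrite mul0r.
by rewrite eqxx mulr1.
Qed.

Lemma boundaries_sub i : (boundaries F i.+1 j <= cycles F i.+1 j)%MS.
Proof.
rewrite /= sub_capmx; apply/andP; split.
  apply/row_subP => a; rewrite row_mul; apply/degree_partP => l.
  rewrite mxE => ne; have [b] : exists b, row a (degree_part F i.+2 j) 0 b * diffK F i.+1 b l != 0.
    apply/existsP; apply: contraNT ne => /existsPn h; apply/eqP/big1 => b _.
    by apply/eqP; rewrite -[_ == _]negbK h.
  rewrite mulf_eq0 negb_or !mxE => /andP[].
  have [<-|_] := eqVneq a b; last by rewrite mulr0n eqxx.
  rewrite mulr1n => hb /diff_deg; rewrite mdeg0 add0n => ->.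
  by apply/eqP; apply: contraNT hb => /negPf->.
apply/sub_kermxP; rewrite /boundaries -mulmxA -[_ *m diffK F i](const_coeffsM (diff F i.+1)).
by rewrite diff_diff /const_coeffs map_mx0 mulmx0.
Qed.

(** At the index setT, where p = 0, the image of the Koszul differential
consists of the vectors without constant coefficients. *)
Lemma boundary_of_const_coeffs q (z : chain 0 q) (v : chain 0 q.+1) : graded z -> graded v ->
  const_coeffs (z setT) = const_coeffs (dF v setT) -> ~ chain_nonboundary z.
Proof.
move=> hz hv e nz; have hzv : graded (z - dF v) by apply: gradedB => //; apply: graded_dF.
have [|l|u hu zu] := @exact_kF _ _ _ _ _ 0 q (z - dF v) hzv.
- move=> l B; rewrite /koszX /kosz big1 // => k kB; rewrite /component (graded0 hzv) ?mxE ?mulr0 //.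
  have := max_card (mem B); rewrite card_ord -(card_rem kB); lia.
- rewrite /component !ffunE !mxE mcoeffB; move/rowP: e => /(_ l); rewrite !mxE !ffunE => ->.
  by rewrite mxE subrr.
by apply: (nz u v) => //; rewrite -zu subrK.
Qed.

Lemma betti_neq0P i : betti F i.+1 j != 0%N <->
  exists z : chain 0 i.+1, [/\ graded z, chain_nonboundary z & exists2 y : chain 1 i, graded y & dF z = kF y].
Proof.
split.
  rewrite -lt0n subn_gt0 => lt.
  have : ~~ (cycles F i.+1 j <= boundaries F i.+1 j)%MS.
    by apply/negP => /mxrankS; rewrite leqNgt lt.
  case/row_subPn => a; set v := row a _ => nv.
  have vC : (v <= cycles F i.+1 j)%MS by apply: row_sub.
  move: vC; rewrite /= sub_capmx => /andP[/degree_partP vD /sub_kermxP vK].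
  exists (constant_chain v); have hv := graded_constant_chain vD; split => //.
    move=> x w hx hw e; case/negP: nv.
    have /submxP[x' ex] : (const_coeffs (w setT) <= degree_part F i.+2 j)%MS.
      by apply/degree_partP => l; apply: graded_const_coeffs hw.
    have -> : v = x' *m boundaries F i.+1 j; last exact: submxMl.
    have -> : v = const_coeffs (kF x setT) + const_coeffs (dF w setT).
      by rewrite -[LHS]const_coeffs_constant_chain e ffunE /const_coeffs map_mxD.
    by rewrite const_coeffs_kF add0r ffunE const_coeffsM ex /boundaries mulmxA.
  have hdv : graded (dF (constant_chain v)) by apply: graded_dF.
  have [|l|y hy ey] := @exact_kF _ _ _ _ _ 0 i (dF (constant_chain v)) hdv; last by exists y.
  - move=> l B; rewrite /koszX /kosz big1 // => k kB; rewrite /component (graded0 hdv) ?mxE ?mulr0 //.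
    have := max_card (mem B); rewrite card_ord -(card_rem kB); lia.
  - have : const_coeffs (dF (constant_chain v) setT) = 0 by rewrite ffunE const_coeffsM const_coeffs_constant_chain.
    by move=> /rowP/(_ l); rewrite !mxE.
case=> z [hz nz [y hy zy]]; rewrite -lt0n subn_gt0.
rewrite (ltn_leqif (mxrank_leqif_sup (boundaries_sub i))).
have zC : (const_coeffs (z setT) <= cycles F i.+1 j)%MS.
  rewrite /= sub_capmx; apply/andP; split; first by apply/degree_partP => l; apply: graded_const_coeffs hz.
  apply/sub_kermxP; rewrite -[diffK F i]/(const_coeffs (diff F i)) -const_coeffsM.
  by move/ffunP: zy => /(_ setT); rewrite ffunE => ->; rewrite const_coeffs_kF.
apply/negP => /(submx_trans zC)/submxP[x ex]; pose v : 'rV_(rk F i.+2) := x *m degree_part F i.+2 j.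
have hv : graded (constant_chain v) by apply/graded_constant_chain/degree_partP; rewrite submxMl.
apply: (boundary_of_const_coeffs hz hv) nz.
by rewrite ex ffunE const_coeffsM const_coeffs_constant_chain /boundaries mulmxA.
Qed.

End Tor.

(** * The edge Koszul (x) S/I and Hochster's formula *)

Section Twist.
Local Open Scope ring_scope.
Variables (K : fieldType) (n : nat).
Implicit Types (k : 'I_n) (B W s : {set 'I_n}) (g : {set 'I_n} -> K).

Definition outer_sign W s : K := \prod_(k in s) sgn K k (~: W).

Lemma outer_signK W s : outer_sign W s * outer_sign W s = 1.
Proof. by rewrite /outer_sign -big_split /= big1 // => k _; rewrite sgnK. Qed.

(** In multidegree mset W only the indices B = s :|: ~: W with s contained in W
occur. The sign of k in B counts in addition the elements of ~: W below k, which
[outer_sign] absorbs. *)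
Definition twist W g s := outer_sign W s * g (s :|: ~: W).

Lemma sgnU k (A B : {set 'I_n}) : [disjoint A & B] -> sgn K k (A :|: B) = sgn K k A * sgn K k B.
Proof.
move=> dAB; rewrite /sgn -exprD; congr (_ ^+ _); rewrite /nbelow.
have -> : [set l in A :|: B | (l < k)%N] = [set l in A | (l < k)%N] :|: [set l in B | (l < k)%N].
  by apply/setP => l; rewrite !inE andb_orl.
apply/eqP; rewrite (leq_card_setU _ _).2; apply/pred0P => l /=; rewrite !inE.
by have /pred0P/(_ l) /= := dAB; case: (l \in A); case: (l \in B); rewrite ?andbF.
Qed.

Lemma kosz1_twist W g s : (forall B, ~~ (~: B \subset W) -> g B = 0) -> s \subset W ->
  kosz1 (twist W g) s = outer_sign W s * kosz1 g (s :|: ~: W).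
Proof.
move=> g0 sW; rewrite /kosz1 /kosz mulr_sumr.
rewrite [RHS](bigID (fun k => k \in W)) /= [X in _ + X]big1 ?addr0; last first.
  move=> k /andP[kB kW]; rewrite g0 ?mulr0 //; apply/subsetPn; exists k => //.
  by rewrite !inE eqxx.
rewrite [RHS](eq_bigl (mem s)); last first.
  move=> k /=; rewrite !inE; have [ks|] := boolP (k \in s); first by rewrite (subsetP sW).
  by move=> _; rewrite /= andNb.
apply: eq_bigr => k ks; have kW := subsetP sW k ks.
have -> : (s :|: ~: W) :\ k = (s :\ k) :|: ~: W.
  apply/setP => l; rewrite !inE; case: (eqVneq l k) => [->|] //=; by rewrite kW.
rewrite sgnU; last first.
  by apply/pred0P => l /=; rewrite inE; apply/negP => /andP[/(subsetP sW)->].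
rewrite /twist /outer_sign (big_setD1 k ks) /=.
rewrite !mulr1; set a := sgn K k s; set b := sgn K k _; set c := \prod_(_ in _) _; set x := g _.
have -> : b * c * (a * b * x) = b * b * (a * (c * x)) by ring.
by rewrite sgnK mul1r.
Qed.

Definition untwist W g B := if ~: B \subset W then outer_sign W (B :&: W) * g (B :&: W) else 0.

Lemma setUCI W s : s \subset W -> (s :|: ~: W) :&: W = s.
Proof.
by move=> sW; rewrite setIUl [~: W :&: W]setIC setICr setU0; apply/setIidPl.
Qed.

Lemma setIUC W B : ~: B \subset W -> (B :&: W) :|: ~: W = B.
Proof.
move=> BW; rewrite setUIl setUCr setIT; apply/setUidPl.
by rewrite -setCS setCK.
Qed.

Lemma setCU_sub W s : ~: (s :|: ~: W) \subset W.
Proof. by rewrite setCU setCK subsetIr. Qed.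

Lemma twistK W g s : s \subset W -> twist W (untwist W g) s = g s.
Proof. by move=> sW; rewrite /twist /untwist setCU_sub setUCI // mulrA outer_signK mul1r. Qed.

Lemma kosz1_untwist W g s : s \subset W ->
  kosz1 (untwist W g) (s :|: ~: W) = outer_sign W s * kosz1 g s.
Proof.
move=> sW; have -> : kosz1 g s = kosz1 (twist W (untwist W g)) s.
  by apply: eq_kosz => k ks; rewrite twistK // (subset_trans _ sW) // subsetDl.
rewrite kosz1_twist // ?mulrA ?outer_signK ?mul1r // => B; rewrite /untwist.
by move=> /negPf->.
Qed.

Lemma card_outer W s p : s \subset W -> (#|s :|: ~: W| + p = n)%N <-> (#|s| + p = #|W|)%N.
Proof.
move=> sW; have -> : #|s :|: ~: W| = (#|s| + #|~: W|)%N.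
  apply/eqP; rewrite (leq_card_setU _ _).2; apply/pred0P => l /=; rewrite inE.
  by apply/negP => /andP[/(subsetP sW)->].
have e : (#|W| + #|~: W| = n)%N by rewrite cardsC card_ord.
rewrite -[X in _ = X <-> _]e addnAC; split => [/addIn|->] //.
Qed.

Lemma mset_subset W B : (mset (~: B) <= mset W)%MM = (~: B \subset W).
Proof.
apply/mset_le/subsetP => h k /h; by rewrite msetE; case: (k \in W).
Qed.

Lemma mset_sub W s : s \subset W -> (mset W - mset (~: (s :|: ~: W)))%MM = mset s.
Proof.
move=> sW; apply/mnmP => k; rewrite mnmBE !msetE !inE negb_or negbK.
have [/(subsetP sW)-> //|_] := boolP (k \in s); by rewrite /= subnn.
Qed.
End Twist.

Section Hochster.
Local Open Scope ring_scope.
Variables (K : fieldType) (n : nat) (E : rel 'I_n).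
Hypothesis E_irr : irreflexive E.
Local Notation S := {mpoly K[n]}.
Local Notation I := (@edge_ideal K n E).
Variable F : resolution I.
Variable j : nat.
Implicit Types (m mu : 'X_{1..n}) (B W s : {set 'I_n}) (f g : {set 'I_n} -> S).
Local Notation chain := (chain F).
Local Notation graded := (graded j).
Local Notation chain_nonboundary := (chain_nonboundary j).
Local Notation standard := (standard E).

Lemma standard_supp m m' : (forall i, (0 < m' i)%N -> (0 < m i)%N) -> standard m -> standard m'.
Proof.
move=> h; apply: contra => /existsP[a /existsP[b /and3P[ab ma mb]]].
by apply/existsP; exists a; apply/existsP; exists b; rewrite ab !h.
Qed.

Lemma standard_mset s : standard (mset s) = indep E s.
Proof.
apply/idP/indepP => [h x y xs ys|h].
  apply: contra h => xy; apply/existsP; exists x; apply/existsP; exists y.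
  by rewrite xy !msetE xs ys.
apply/negP => /existsP[x /existsP[y /and3P[xy]]]; rewrite !msetE !lt0b => xs ys.
by move: (h x y xs ys); rewrite xy.
Qed.

Definition eq_std f g := forall B m, standard m -> (f B)@_m = (g B)@_m.

(** I is an ideal: divisors of standard monomials are standard. *)
Lemma koszX_std f g : eq_std f g -> eq_std (koszX f) (koszX g).
Proof.
move=> h B m sm; rewrite !raddf_sum /=; apply: eq_bigr => k kB.
rewrite -!mulrA !mcoeff_sgn !mcoeffXM; case: ifP => // _; congr (_ * _); apply: h.
by apply: standard_supp sm => i; rewrite mnmBE; lia.
Qed.

Lemma augFB p (x y : chain p 0) B : augF (x - y) B = augF x B - augF y B.
Proof. by rewrite /augF !ffunE mulmxBl !mxE. Qed.

Lemma mpart_std mu f g B : (mset (~: B) <= mu)%MM -> standard (mu - mset (~: B))%MM ->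
  eq_std f g -> mpart mu f B = mpart mu g B.
Proof. by rewrite /mpart => -> sm h; apply: h. Qed.

Lemma mpart_I mu f B : (mset (~: B) <= mu)%MM -> standard (mu - mset (~: B))%MM ->
  (forall B, I (f B)) -> mpart mu f B = 0.
Proof. by rewrite /mpart => -> sm h; have /(edge_idealP E_irr) := h B; apply. Qed.

(** A cocycle on the faces s of W gives a Koszul cycle modulo I, of multidegree
mset W, with the monomial mset s at the index s :|: ~: W. *)
Lemma tor_of_nonacyclic i W c : #|W| = j -> (i + c = j)%N -> (0 < i)%N -> nonacyclic K E W c ->
  exists z : chain i 0, [/\ graded z, chain_nonboundary z & forall B, I (koszX (augF z) B)].
Proof.
move=> Wj icj i0 [f cf nf].
pose fc s := if #|s| == c then f s else 0.
pose q B : S := (untwist W fc B) *: 'X_[mset (B :&: W)].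
have mpart_q mu B : mpart mu q B = if mu == mset W then untwist W fc B else 0.
  have [le|nle] := boolP (mset (~: B) <= mu)%MM; last first.
    rewrite mpart_support //; case: eqP => // e; rewrite e mset_subset in nle.
    by rewrite /untwist (negPf nle).
  rewrite /mpart le mcoeffZ mcoeffX.
  have [BW|nBW] := boolP (~: B \subset W); last by rewrite /untwist (negPf nBW) mul0r if_same.
  have -> : mset (B :&: W) = (mset W - mset (~: B))%MM.
    by rewrite -{2}(setIUC BW) mset_sub // subsetIr.
  have -> : (mset W - mset (~: B) == mu - mset (~: B))%MM = (mu == mset W).
    apply/eqP/eqP => [e|-> //]; by rewrite -(submK le) -e submK // mset_subset.
  by case: eqP; rewrite ?mulr1 ?mulr0.
have famq : homog_family j 0 i q.
  apply: homog_family_of_mpart => mu B; rewrite mpart_q; case: (eqVneq mu (mset W)) => [->|]; rewrite ?eqxx //.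
  rewrite /untwist mdeg_mset addn0 Wj; case: ifP => [BW|]; rewrite ?eqxx //.
  rewrite /fc; case: (eqVneq #|B :&: W| c) => [e|]; rewrite ?mulr0 ?eqxx // => _; split => //.
  by rewrite -(setIUC BW); apply/card_outer; rewrite ?subsetIr // e Wj -icj addnC.
have [z hz qz] := augF_surj E_irr F famq; exists z; split => //; last first.
  move=> B; apply/(edge_idealP E_irr) => m sm; rewrite -(koszX_std qz) // mpart_mcoeff mpart_kosz.
  rewrite /kosz1; set mu := (m + _)%MM.
  have [e|ne] := eqVneq mu (mset W); last first.
    by apply: big1 => k _; rewrite mpart_q (negPf ne) mulr0.
  have BW : ~: B \subset W by rewrite -mset_subset -e lem_addl.
  have -> : kosz (fun=> 1) (mpart mu q) B = kosz1 (untwist W fc) B.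
    by apply: eq_kosz => k _; rewrite mpart_q e eqxx.
  rewrite -(setIUC BW) kosz1_untwist ?subsetIr //.
  set s := B :&: W; have sW : s \subset W by apply: subsetIr.
  have si : indep E s.
    rewrite -standard_mset -(mset_sub sW) setIUC // -e addmK //.
  have [sc|sc] := eqVneq #|s| c.+1.
    have -> : kosz1 fc s = coboundary f s.
      by apply: eq_kosz => k ks; rewrite /fc -eqSS card_rem // sc eqxx.
    by rewrite cf ?mulr0.
  rewrite [kosz1 _ _]big1 ?mulr0 // => k ks.
  by rewrite /fc -eqSS card_rem // (negPf sc) mulr0.
move=> u v hu hv zuv; apply: nf; exists (twist W (mpart (mset W) (augF u))) => s sW si sc.
rewrite -[RHS]/(kosz1 _ _) kosz1_twist //; last first.
  by move=> B; rewrite -mset_subset; apply: mpart_support.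
rewrite -mpart_kosz; have -> : f s = outer_sign K W s * mpart (mset W) q (s :|: ~: W).
  by rewrite mpart_q eqxx -[RHS]/(twist _ _ _) twistK // /fc sc eqxx.
congr (_ * _); apply: mpart_std; rewrite ?mset_subset ?setCU_sub ?mset_sub ?standard_mset //.
move=> B m sm; rewrite qz // -augF_kF; apply/eqP; rewrite -subr_eq0 -mcoeffB -augFB zuv.
rewrite addrC addKr; apply/eqP; move: m sm; apply/(edge_idealP E_irr); exact: augF_dF.
Qed.

(** If every W were acyclic, z would be a boundary modulo I in each multidegree.
For mu k >= 2 contraction with k is a homotopy, since mu - mset (~: B) has the
same support whether or not k belongs to B; the other mu are the mset W. *)
Lemma nonacyclic_of_tor i (z : chain i 0) : graded z -> chain_nonboundary z -> (0 < i)%N ->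
  (forall B, I (koszX (augF z) B)) -> exists W c, [/\ #|W| = j, (i + c = j)%N & nonacyclic K E W c].
Proof.
move=> hz nz i0 kz; apply: NNPP => noW; set q := augF z.
have fq : homog_family j 0 i q by apply: homog_family_augF.
have [|w hw ew] := @koszul_solve _ _ standard _ _ _ _ fq; last first.
  have [u hu uw] := augF_surj E_irr F hw.
  have [||v hv ev] := @exact_augF _ _ _ F j i (z - kF u).
  - by apply: gradedB => //; apply: graded_kF.
  - move=> B; apply/(edge_idealP E_irr) => m sm; rewrite augFB augF_kF mcoeffB -/q ew //.
    by rewrite (koszX_std uw) // subrr.
  by apply: (nz u v) => //; rewrite -ev addrC subrK.
move=> mu; rewrite addn0 => muj.
have [/existsP[k muk]|/existsPn mu1] := boolP [exists k, 1 < mu k]%N.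
  exists (contract k (mpart mu q)); split=> [B|B _ le sm].
    by apply: contract_support => //; [apply: ltn_trans muk | apply: mpart_support].
  have := kosz_homotopy (fun=> 1) k (mpart mu q) B; rewrite mul1r => <-.
  rewrite [X in _ + X](_ : _ = 0) ?addr0 // /contract; case: ifPn => // kB.
  have lek : (mset (~: (k |: B)) <= mu)%MM.
    by move: le; rewrite -{1}(setU1K kB) mset_leD1 ?setU11 // => /andP[].
  rewrite -[kosz _ _ _]/(kosz1 _ _) -mpart_kosz mpart_I ?mulr0 //.
  apply: standard_supp sm => a; rewrite !mnmBE !msetE !inE negb_or.
  by case: (eqVneq a k) => [->|_] //=; rewrite kB; lia.
(* Here mu is squarefree. *)
pose W := [set k | (0 < mu k)%N]; have muW : mu = mset W.
  apply/mnmP => k; rewrite msetE inE; move: (mu1 k); case: (mu k) => [|[]] //.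
rewrite muW mdeg_mset in muj *.
have [ij|ji] := leqP i j; last first.
  exists (fun=> 0); split=> // B cB; rewrite mset_subset => BW; exfalso.
  by have := subset_leq_card BW; rewrite (card_compl cB) muj leqNgt ji.
set c := mpart _ q; have c0 B : ~~ (~: B \subset W) -> c B = 0.
  by rewrite -mset_subset; apply: mpart_support.
have [g hg] : exact_on E W (j - i) (twist W c).
  apply: NNPP => nex; apply: noW; exists W, (j - i)%N; split=> //; first by rewrite subnKC.
  exists (twist W c) => // s sW si sc; rewrite -[LHS]/(kosz1 _ _) kosz1_twist // -mpart_kosz.
  by rewrite mpart_I ?mulr0 ?mset_subset ?setCU_sub ?mset_sub ?standard_mset.
exists (untwist W g); split=> [B|B cB].
  by rewrite mset_subset /untwist => /negPf->.
rewrite mset_subset => BW; rewrite -{1}(setIUC BW) mset_sub ?subsetIr // standard_mset => si.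
have sW : B :&: W \subset W by apply: subsetIr.
rewrite -(setIUC BW) kosz1_untwist // -[kosz1 _ _]hg //; last first.
  move: cB; rewrite -{1}(setIUC BW) => /card_outer-/(_ sW) e; rewrite -muj -e addnK //.
by rewrite /twist mulrA outer_signK mul1r.
Qed.

(** Hochster's formula, up to dimensions: the two edges are related by [zigzag],
applied to the double complex and to its transpose. *)
Lemma bettiP i : (0 < i)%N -> betti F i j != 0%N <->
  exists W c, [/\ #|W| = j, (i + c = j)%N & nonacyclic K E W c].
Proof.
case: i => // i _; split=> [/betti_neq0P[z [hz nz [y hy zy]]]|[W [c [Wj cj h]]]].
  have nz' : nonboundary (V := fun p q => chain q p) (fun p q => @graded q p)
     (fun p q => @kF _ _ _ F q p) (fun p q => @dF _ _ _ F q p) (p := i.+1) (q := 0) z.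
    by move=> u v hu hv e; apply: (nz v u) => //; rewrite addrC.
  have [||||||||||x [hx nx [y' hy' e]]] :=
      zigzag _ _ _ _ _ _ _ _ _ _ (esym (addn0 i)) hz nz' (ex_intro2 _ _ y hy zy).
  1-10: move=> *.
  - exact: gradedB.
  - exact: graded_kF.
  - exact: graded_dF.
  - exact: kFD.
  - exact: dFD.
  - exact: kF_kF.
  - exact: dF_dF.
  - by rewrite dF_kF.
  - exact: exact_kFS.
  - exact: exact_dF.
  apply: (nonacyclic_of_tor hx) => // [u v hu hv xe|B].
    by apply: (nx v u) => //; rewrite addrC.
  by rewrite -augF_kF e; apply: augF_dF.
have [z [hz nz kz]] := tor_of_nonacyclic Wj cj (ltn0Sn i) h.
apply/betti_neq0P.
have [||y hy zy] := @exact_augF _ _ _ F j i (kF z).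
- exact: graded_kF.
- by move=> B; rewrite augF_kF.
have [||||||||||x [hx nx [y' hy' e]]] :=
    @zigzag (fun p q => chain p q) (fun p q => @graded p q)
     (fun p q => @dF _ _ _ F p q) (fun p q => @kF _ _ _ F p q)
      _ _ _ _ _ _ _ _ _ _ i 0 i z (esym (addn0 i)) hz nz (ex_intro2 _ _ y hy zy).
1-10: move=> *.
- exact: gradedB.
- exact: graded_dF.
- exact: graded_kF.
- exact: dFD.
- exact: kFD.
- exact: dF_dF.
- exact: kF_kF.
- exact: dF_kF.
- exact: exact_dF.
- exact: exact_kFS.
by exists x; split => //; exists y'.
Qed.

End Hochster.

(** * Subadditivity *)

Section Subadditivity.
Variables (K : fieldType) (n : nat) (E : rel 'I_n).
Hypotheses (E_sym : ssrbool.symmetric E) (E_irr : irreflexive E).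
Variable F : resolution (@edge_ideal K n E).
Local Notation nz := (nonacyclic K E).
Local Notation t := (max_shift F).

Lemma leq_max_shift_nonacyclic a (W : {set 'I_n}) c : 0 < a -> a + c = #|W| -> nz W c -> #|W| <= t a.
Proof.
by move=> a0 e h; apply/leq_max_shift/(bettiP E_irr F) => //; exists W, c; split.
Qed.

Lemma max_shift_attained a : 0 < a -> t a != 0 ->
  exists (W : {set 'I_n}) c, [/\ #|W| = t a, a + c = t a & nz W c].
Proof.
move=> a0 ta; apply/(bettiP E_irr F) => //.
suff [j hj] : exists j, betti F a j != 0 by apply: betti_max_shift hj.
apply: NNPP => nj; case/eqP: ta; rewrite /max_shift big1 // => k hk.
by case: nj; exists (nat_of_ord k).
Qed.

(** The descent by b loses at most ceil(3b/2) vertices, or reaches a perfect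
matching of at least a >= b edges; in the second case the matching shows that
t_b >= 2b. *)
Lemma max_shift_add_half a b : 0 < b -> b <= a -> uphalf (3 * b) <= t b -> t (a + b) <= t a + t b.
Proof.
move=> b0 ba tb; have [->//|tab] := eqVneq (t (a + b)) 0.
have ab0 : 0 < a + b by slia.
have a0 : 0 < a by slia.
have [W [c [Wt ec h]]] := max_shift_attained ab0 tab.
have bW : b <= #|W| - c by slia.
case: (nonacyclic_down_half E_sym E_irr h bW) => [[W' [c' [h' e1 e2]]]|[W' [c' [h' e1 e2]]]].
  have /(leq_max_shift_nonacyclic a0)/(_ h') : a + c' = #|W'| by slia.
  rewrite -[uphalf _]/((3 * b).+1./2) in tb; slia.
have mW' : c' - b <= #|W'| - c' by slia.
have [U [d [_ hU e3 e4]]] := nonacyclic_down E_sym E_irr h' mW'.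
have /(leq_max_shift_nonacyclic b0)/(_ hU) : b + d = #|U| by slia.
have [V [d' [_ hV e5 e6]]] := nonacyclic_down E_sym E_irr h bW.
have /(leq_max_shift_nonacyclic a0)/(_ hV) : a + d' = #|V| by slia.
slia.
Qed.

Lemma max_shift_gt a b : 0 < b -> t (a + b) != 0 -> b < t b.
Proof.
move=> b0 tab; have ab0 : 0 < a + b by slia.
have [W [c [Wt ec h]]] := max_shift_attained ab0 tab.
have aW : a <= #|W| - c by slia.
have [U [d [_ hU e3 e4]]] := nonacyclic_down E_sym E_irr h aW.
have d0 : 0 < d by apply: (nonacyclic_gt0 E_irr hU); rewrite -card_gt0; slia.
have /(leq_max_shift_nonacyclic b0)/(_ hU) : b + d = #|U| by slia.
slia.
Qed.

Lemma max_shift_add_small a b : 3 <= b <= 4 -> b <= a -> t b < b.+2 -> t (a + b) <= t a + t b.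
Proof.
move=> b34 ba tb; have [->//|tab] := eqVneq (t (a + b)) 0.
have b0 : 0 < b by slia.
have ab0 : 0 < a + b by slia.
have a0 : 0 < a by slia.
have bt := max_shift_gt b0 tab.
have [W [c [Wt ec h]]] := max_shift_attained ab0 tab.
have bW : b + b <= #|W| - c by slia.
case: (nonacyclic_down_one E_sym E_irr b34 (leqnn b) h bW) => [[W' [c' [h' e1 e2]]]|[U [d [hU e1 d2]]]].
  have /(leq_max_shift_nonacyclic a0)/(_ h') : a + c' = #|W'| by slia.
  slia.
have /(leq_max_shift_nonacyclic b0)/(_ hU) : b + d = #|U| by slia.
slia.
Qed.

Lemma max_shift_add a b : b <= a -> (5 <= b -> uphalf (3 * b) <= t b) -> t (a + b) <= t a + t b.
Proof.
move=> ba tb; have [->//|tab] := eqVneq (t (a + b)) 0.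
have [->|b0] := posnP b; first by rewrite addn0 leq_addr.
have bt := max_shift_gt b0 tab.
have [b5|b5] := leqP 5 b; first exact: (max_shift_add_half b0 ba (tb b5)).
have [b2|b3] := leqP b 2.
  by apply: max_shift_add_half => //; rewrite -[uphalf _]/((3 * b).+1./2); slia.
have b34 : 3 <= b <= 4 by slia.
have [tb2|tb2] := ltnP (t b) b.+2; first exact: max_shift_add_small.
by apply: max_shift_add_half => //; rewrite -[uphalf _]/((3 * b).+1./2); slia.
Qed.

End Subadditivity.

Local Open Scope ring_scope.

Theorem corollary3p6 (K : fieldType) (n : nat) (E : rel 'I_n)
    (E_sym : ssrbool.symmetric E) (E_irr : irreflexive E)
    (F : resolution (@edge_ideal K n E)) (p : nat)
    (pd_p : is_pd (@edge_ideal K n E) p) :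
  ((forall j : nat, (5 <= j)%N -> (j <= p./2)%N ->
      (uphalf (3 * j) <= max_shift F j)%N) ->
    subadditive F p)
  /\ ((p <= 9)%N -> subadditive F p).
Proof.
have main : (forall j : nat, (5 <= j)%N -> (j <= p./2)%N ->
    (uphalf (3 * j) <= max_shift F j)%N) -> subadditive F p.
  move=> h a b abp.
  have [ba|/ltnW ab] := leqP b a.
    by apply: max_shift_add => // b5; apply: h => //; lia.
  by rewrite addnC [leqRHS]addnC; apply: max_shift_add => // a5; apply: h => //; lia.
by split=> // p9; apply: main => j j5 jp; exfalso; lia.
Qed.
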